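(* Let $q\equiv1\pmod 6$ be a prime power, $\eta\in\widehat{\mathbb F_q^\times}$ a primitive character of order $3$, and $A,B\in\widehat{\mathbb F_q^\times}$ such that none of $A^3$, $B$, $A^3\overline B^2$, $A^6\overline B^3$, $\phi A^3\overline B$, $\phi A^3\overline B^3$ is trivial. Then for all $x\in\mathbb F_q$, $$\overline A^3(1-x)\,{}_3\mathbb F_2\!\left[\begin{matrix}A&A\eta&A\overline\eta\\&\phi B&A^3\overline B\end{matrix};\frac{27x}{4(x-1)^3}\right]={}_3\mathbb F_2\!\left[\begin{matrix}A^3&A^3\overline B^2&\overline A^3B^2\\&A^3\overline B&\phi B\end{matrix};\frac x4\right]-\delta(x+\tfrac12)A^3(2)\frac{g(\phi)g(\overline A^3)}{g(\phi\overline B)g(\overline A^3B)}-\delta(1-x)\sum_{\substack{\chi\in\widehat{\mathbb F_q^\times}\\\chi^3=\overline A^3}}\frac{g(\overline\chi)g(\phi\overline{B\chi})g(B\overline{A^3\chi})}{g(\phi\overline B)g(\overline A^3B)g(A^3)}\overline\chi(4),$$ where for $x=1$ the left-hand side is interpreted as $0$.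
   Context: $\mathbb F_q$ is a finite field with $q$ elements, $q$ a power of an odd prime $p$. $\widehat{\mathbb F_q^\times}$ is the group of multiplicative characters $\chi:\mathbb F_q^\times\to\mathbb C^\times$; every character, including the trivial character $\varepsilon$, is extended to $\mathbb F_q$ by $\chi(0)=0$. $\phi$ is the quadratic character, $\overline\chi$ denotes the complex-conjugate (inverse) character, and products/powers of characters are pointwise. For $x\in\mathbb F_q$, $\delta(x)=1$ if $x=0$ and $0$ otherwise. Gauss sum: $g(A)=\sum_{x\in\mathbb F_q^\times}A(x)\zeta_p^{\mathrm{Tr}_{\mathbb F_q/\mathbb F_p}(x)}$ with $\zeta_p=e^{2\pi i/p}$. Jacobi sum: $J(A,B)=\sum_{x\in\mathbb F_q}A(x)B(1-x)$. Period functions: ${}_2\mathbb P_1\!\left[\begin{matrix}A&B\\&C\end{matrix};\lambda\right]=\sum_{y\in\mathbb F_q}B(y)\,\overline BC(1-y)\,\overline A(1-\lambda y)$ and ${}_3\mathbb P_2\!\left[\begin{matrix}A_1&A_2&A_3\\&B_1&B_2\end{matrix};\lambda\right]=\sum_{y\in\mathbb F_q}A_3(y)\,\overline{A_3}B_2(1-y)\,{}_2\mathbb P_1\!\left[\begin{matrix}A_1&A_2\\&B_1\end{matrix};\lambda y\right]$; normalized ${}_3\mathbb F_2\!\left[\begin{matrix}A_1&A_2&A_3\\&B_1&B_2\end{matrix};\lambda\right]=\frac{1}{J(A_2,B_1\overline{A_2})J(A_3,B_2\overline{A_3})}\,{}_3\mathbb P_2\!\left[\begin{matrix}A_1&A_2&A_3\\&B_1&B_2\end{matrix};\lambda\right]$.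 *)

(* Defs.v *)
(* Multiplicative characters of a finite field F are modelled
   as functions F -> algC (complex algebraic numbers), extended by chi(0)=0. *)
From HB Require Import structures.
From mathcomp Require Import all_boot all_order all_algebra all_field.
From Stdlib Require Import ClassicalEpsilon.
Set Implicit Arguments. Unset Strict Implicit. Unset Printing Implicit Defensive.
Import Order.TTheory GRing.Theory Num.Theory.
Local Open Scope ring_scope.

Section Chars.
Variable F : finFieldType.

Definition mchar (chi : F -> algC) : Prop :=
  [/\ chi 0 = 0, chi 1 = 1 &
      forall x y : F, x != 0 -> y != 0 -> chi (x * y) = chi x * chi y].

Definition eps : F -> algC := fun x => if x == 0 then 0 else 1.

Definition cmul (A B : F -> algC) : F -> algC := fun x => A x * B x.
Definition cexp (A : F -> algC) (n : nat) : F -> algC := fun x => A x ^+ n.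
Definition cconj (A : F -> algC) : F -> algC := fun x => (A x)^*.

Definition qchar : F -> algC :=
  fun x => if x == 0 then 0 else if [exists y : F, y ^+ 2 == x] then 1 else -1.

Definition delta (x : F) : algC := if x == 0 then 1 else 0.

Definition ftrace (p : nat) (x : F) : F := \sum_(i < logn p #|F|) x ^+ (p ^ i).

(* the representative in {0,..,p-1} of Tr(x) in the prime field F_p *)
Definition trace_nat (p : nat) (x : F) : nat :=
  if [pick k : 'I_p | (k%:R : F) == ftrace p x] is Some k then val k else 0%N.

(* zeta_p = exp(2 pi i / p): p.-root (-1) is exp(i pi / p) in algC *)
Definition zeta (p : nat) : algC := (p.-root (-1)) ^+ 2.

Definition gauss (p : nat) (A : F -> algC) : algC :=
  \sum_(x : F | x != 0) A x * zeta p ^+ trace_nat p x.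

Definition jacobi (A B : F -> algC) : algC := \sum_(x : F) A x * B (1 - x).

Definition P21 (A B C : F -> algC) (lam : F) : algC :=
  \sum_(y : F) B y * cmul (cconj B) C (1 - y) * cconj A (1 - lam * y).

Definition P32 (A1 A2 A3 B1 B2 : F -> algC) (lam : F) : algC :=
  \sum_(y : F) A3 y * cmul (cconj A3) B2 (1 - y) * P21 A1 A2 B1 (lam * y).

Definition F32 (A1 A2 A3 B1 B2 : F -> algC) (lam : F) : algC :=
  P32 A1 A2 A3 B1 B2 lam /
    (jacobi A2 (cmul B1 (cconj A2)) * jacobi A3 (cmul B2 (cconj A3))).

(* sum of G chi over all multiplicative characters chi satisfying P:
   taken along some duplicate-free enumeration of exactly these characters
   (such an enumeration exists since there are finitely many characters). *)
Definition charset_spec (P : (F -> algC) -> Prop) (s : seq {ffun F -> algC}) :=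
  uniq s /\ forall f : {ffun F -> algC}, f \in s <-> (mchar f /\ P f).

Definition char_sum (P : (F -> algC) -> Prop) (G : (F -> algC) -> algC) : algC :=
  \sum_(f <- epsilon (inhabits [::]) (charset_spec P)) G (fun x => f x).

End Chars.
Arguments eps {F}.
Arguments qchar {F}.

(* Main.v *)
Require Import Defs.
From HB Require Import structures.
From mathcomp Require Import all_boot all_order all_fingroup all_algebra.
From mathcomp Require Import all_solvable all_field.
From mathcomp Require Import ring.
From Stdlib Require Import FunctionalExtensionality ClassicalEpsilon.
Import Order.TTheory GRing.Theory Num.Theory.
Set Implicit Arguments. Unset Strict Implicit. Unset Printing Implicit Defensive.
Local Open Scope ring_scope.

(** Writing [g] for Gauss sums and [psi] for the additive character, both
    hypergeometric functions become, up to explicit Gauss sums, exponential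
    sums over five variables.  On the left, the cubic Hasse-Davenport relation
    merges the variables attached to [A], [A eta], [A / eta] into one; the
    resulting phase is homogeneous of degree one, and summing over the scaling
    variable leaves [g(phi)] times the sum over [r, s] of
    [P(r) Q(s) phi(1 - x + r + s + x / (4 r s))], with [P = phi / B] and
    [Q = B / A^3].  On the right, a monomial change of variables and the same
    scaling leave the sum of [P(V) Q(W) phi(f)] over nonzero [a, b, c], where
    [f = U a^2 + V b^2 + W c^2 + a b + b c + c a] and [4 U V W = - x].  The sum
    of [phi(f)] over all [a, b, c] is [q (q - 1) phi(-4 det f)], where
    [4 det f = 1 - U - V - W - x], unless [f] has rank one, which happens only
    for [U = V = W = 1/2]: this is the term at [x = - 1/2].  At [x = 1] the left
    phase depends on the cube of the scaling variable only, whence the sum over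
    the characters with cube [A^-3].

    The Hasse-Davenport relation itself is the identity of the functions
    [K(m) = sum of eta(y / z) psi(t + y + z) over t y z = m] and
    [K0(m) = q * sum of psi(3 n) over n^3 = m].  Their norms and their inner
    product can be computed directly, the inner product because the cubic
    [t + y + z = 3, t y z = 1] is nodal, and the three values show that
    [|K - K0|^2 = 0]. *)

(** * Multiplicative characters *)

Lemma conj_unity_root (n : nat) (z : algC) :
  (0 < n)%N -> z ^+ n = 1 -> z^* = z^-1.
Proof.
move=> n0 zn1; have nz1 : `|z| = 1.
  by apply/eqP; rewrite -(@pexpr_eq1 _ _ n) // -normrX zn1 normr1.
by rewrite invC_norm nz1 expr1n invr1 mul1r.
Qed.

Section Characters.
Variable F : finFieldType.
Implicit Types (X Y : F -> algC) (x y z : F).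

Lemma card_field_gt0 : (0 < #|F|)%N.
Proof. by rewrite ltnW // finNzRing_gt1. Qed.

Lemma card_pred_gt0 : (0 < #|F|.-1)%N.
Proof. by have := finNzRing_gt1 F; case: #|F| => [|[]]. Qed.

Lemma expf_card_pred x : x != 0 -> x ^+ #|F|.-1 = 1.
Proof.
move=> x0; apply: (mulfI x0).
by rewrite mulr1 -exprS prednK ?card_field_gt0 // expf_card.
Qed.

Lemma finField_prim_root : exists u : F, (#|F|.-1).-primitive_root u.
Proof.
pose s := enum (predC1 (0 : F)).
have : has (#|F|.-1).-primitive_root s.
  apply: has_prim_root.
  - exact: card_pred_gt0.
  - apply/allP => x; rewrite mem_enum /= !inE => x0.
    by rewrite unity_rootE expf_card_pred.
  - exact: enum_uniq.
  - by rewrite -cardE cardC1.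
by case/hasP => u _ hu; exists u.
Qed.

Lemma prim_root_neq0 (u : F) : (#|F|.-1).-primitive_root u -> u != 0.
Proof.
move=> hu; apply/eqP => u0; have := prim_expr_order hu.
rewrite u0 expr0n -[_ == 0%N]negbK -lt0n card_pred_gt0 => /eqP.
by rewrite eq_sym oner_eq0.
Qed.

Lemma reindex_scale (c : F) (f : F -> algC) :
  c != 0 -> \sum_y f y = \sum_y f (c * y).
Proof.
by move=> c0; rewrite (reindex_inj (mulfI c0)).
Qed.

Lemma reindex_shift (c : F) (f : F -> algC) : \sum_y f y = \sum_y f (c + y).
Proof. by rewrite (reindex_inj (addrI c)). Qed.

Lemma reindex_inv (f : F -> algC) : \sum_y f y = \sum_y f y^-1.
Proof. by rewrite (reindex_inj invr_inj). Qed.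

Lemma sum_const (a : algC) : \sum_(x : F) a = #|F|%:R * a.
Proof. by rewrite sumr_const mulr_natl. Qed.

Lemma mchar0 X : mchar X -> X 0 = 0. Proof. by case. Qed.

Lemma mchar1 X : mchar X -> X 1 = 1. Proof. by case. Qed.

Lemma mcharM X : mchar X -> forall x y, X (x * y) = X x * X y.
Proof.
case=> X0 _ XM x y; have [->|x0] := eqVneq x 0; first by rewrite mul0r X0 mul0r.
by have [->|y0] := eqVneq y 0; [rewrite mulr0 X0 mulr0 | exact: XM].
Qed.

Lemma mcharX X : mchar X -> forall n x, X (x ^+ n) = X x ^+ n.
Proof.
move=> hX; elim=> [|n IH] x; first by rewrite !expr0 mchar1.
by rewrite !exprS mcharM // IH.
Qed.

Lemma mchar_neq0 X : mchar X -> forall x, (X x == 0) = (x == 0).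
Proof.
move=> hX x; have [->|x0] := eqVneq x 0; first by rewrite mchar0 ?eqxx.
apply/eqP => Xx0; have := mcharM hX x x^-1.
by rewrite divff // mchar1 // Xx0 mul0r; apply/eqP; rewrite oner_eq0.
Qed.

(** With [0^-1 = 0] in both fields the identity holds at zero as well, so inverses of character
    values need no side condition. *)
Lemma mcharV X : mchar X -> forall x, X x^-1 = (X x)^-1.
Proof.
move=> hX x; have [->|x0] := eqVneq x 0; first by rewrite invr0 mchar0 ?invr0.
have Xx0 : X x != 0 by rewrite mchar_neq0.
by apply: (mulfI Xx0); rewrite -mcharM // !divff // mchar1.
Qed.

Lemma mchar_conj X : mchar X -> forall x, (X x)^* = (X x)^-1.
Proof.
move=> hX x; have [->|x0] := eqVneq x 0.
  by rewrite mchar0 // rmorph0 invr0.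
apply: (conj_unity_root card_pred_gt0).
by rewrite -mcharX // expf_card_pred // mchar1.
Qed.

Lemma cmulE X Y x : cmul X Y x = X x * Y x. Proof. by []. Qed.

Lemma cexpE X n x : cexp X n x = X x ^+ n. Proof. by []. Qed.

Lemma cconjE X x : mchar X -> cconj X x = (X x)^-1.
Proof. by move=> hX; rewrite /cconj mchar_conj. Qed.

Lemma mchar_cmul X Y : mchar X -> mchar Y -> mchar (cmul X Y).
Proof.
move=> hX hY; split; rewrite /cmul.
- by rewrite !mchar0 // mulr0.
- by rewrite !mchar1 // mulr1.
- by move=> x y _ _; rewrite !mcharM // mulrACA.
Qed.

Lemma mchar_cexp X n : mchar X -> mchar (cexp X n.+1).
Proof.
move=> hX; split; rewrite /cexp.
- by rewrite mchar0 // expr0n.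
- by rewrite mchar1 // expr1n.
- by move=> x y _ _; rewrite mcharM // exprMn.
Qed.

Lemma mchar_cconj X : mchar X -> mchar (cconj X).
Proof.
move=> hX; split; rewrite /cconj.
- by rewrite mchar0 // rmorph0.
- by rewrite mchar1 // rmorph1.
- by move=> x y _ _; rewrite mcharM // rmorphM.
Qed.

Lemma mchar_eps : mchar (@eps F).
Proof.
split; rewrite /eps ?eqxx ?oner_eq0 // => x y x0 y0.
by rewrite mulf_eq0 (negPf x0) (negPf y0) mulr1.
Qed.

Lemma mcharN1 X : mchar X -> X (-1) * X (-1) = 1.
Proof. by move=> hX; rewrite -mcharM // mulrNN mulr1 mchar1. Qed.

Lemma mcharN1V X : mchar X -> (X (-1))^-1 = X (-1).
Proof. by move=> hX; rewrite -mcharV // invrN1. Qed.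

Lemma eq_mchar X Y : mchar X -> mchar Y ->
  (forall x, x != 0 -> X x = Y x) -> X = Y.
Proof.
move=> hX hY eqXY; apply: functional_extensionality => x.
by have [->|/eqXY //] := eqVneq x 0; rewrite !mchar0.
Qed.

Lemma mchar_neq_eps X : mchar X -> X <> eps -> exists2 a, a != 0 & X a != 1.
Proof.
move=> hX neq; case: (pickP (fun a => (a != 0) && (X a != 1))) => [a /andP[]|h].
  by exists a.
case: neq; apply: eq_mchar => //; first exact: mchar_eps.
move=> x x0; rewrite /eps (negPf x0); apply/eqP.
by have := h x; rewrite x0 /= => /negbFE.
Qed.

Lemma sum_mchar X : mchar X -> X <> eps -> \sum_x X x = 0.
Proof.
move=> hX /(mchar_neq_eps hX)[a a0 Xa].
have : (X a - 1) * \sum_x X x = 0.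
  rewrite mulrBl mul1r {2}(reindex_scale _ a0) mulr_sumr.
  by rewrite -sumrB big1 // => x _; rewrite mcharM // subrr.
by move/eqP; rewrite mulf_eq0 subr_eq0 (negPf Xa) => /eqP.
Qed.

Lemma cconj_neq_eps X : mchar X -> X <> eps -> cconj X <> eps.
Proof.
move=> hX /(mchar_neq_eps hX)[a a0 Xa] /(congr1 (fun f => f a)).
rewrite cconjE // /eps (negPf a0) => /eqP.
by rewrite invr_eq1 (negPf Xa).
Qed.

End Characters.

(** * The additive character attached to the trace *)

(** The vanishing total sum encodes nontriviality in the form in which orthogonality uses it. *)
Definition add_char (F : finFieldType) (psi : F -> algC) : Prop :=
  [/\ psi 0 = 1, forall x y, psi (x + y) = psi x * psi y & \sum_x psi x = 0].

Section TraceCharacter.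
Variables (F : finFieldType) (p : nat).
Hypothesis hp : p \in [pchar F].
Implicit Types x y : F.

Let p_prime : prime p := pcharf_prime hp.

Lemma ftraceD x y : ftrace p (x + y) = ftrace p x + ftrace p y.
Proof.
rewrite -big_split; apply: eq_bigr => i _ /=.
by rewrite exprDn_pchar // pnatX (pnatE _ p_prime) hp.
Qed.

Lemma card_pchar : #|F| = (p ^ logn p #|F|)%N.
Proof. exact: (card_pprimeChar hp). Qed.

Lemma logn_card_gt0 : (0 < logn p #|F|)%N.
Proof.
rewrite lt0n; apply/eqP => l0; have := finNzRing_gt1 F.
by rewrite card_pchar l0.
Qed.

(** Frobenius moves each conjugate in the trace to the next one, and the last one returns to [x]
    because [x ^+ #|F| = x]. *)
Lemma ftrace_frob x : ftrace p x ^+ p = ftrace p x.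
Proof.
rewrite -(pFrobenius_autE hp) rmorph_sum /= /ftrace.
under eq_bigr do rewrite pFrobenius_autE -exprM -expnSr.
have := card_pchar; have := logn_card_gt0.
case: (logn p #|F|) => [//|n] _ cF.
by rewrite big_ord_recr big_ord_recl /= -cF expf_card expn0 expr1 addrC.
Qed.

Lemma natr_eq_mod (m n : nat) : (m%:R == n%:R :> F) = (m == n %[mod p]).
Proof.
wlog le : m n / (n <= m)%N.
  by move=> h; case/orP: (leq_total n m) => /h //; rewrite eq_sym => ->; rewrite eq_sym.
by rewrite eqn_mod_dvd // (dvdn_pcharf hp) natrB // subr_eq0.
Qed.

(** The images of [0, ..., p - 1] are already [p] distinct roots of ['X^p - 'X]; a fixed point
    outside them would be one root too many. *)
Lemma frob_fixed x : x ^+ p = x -> exists k : 'I_p, k%:R = x.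
Proof.
move=> xp; case: (pickP (fun k : 'I_p => (k%:R : F) == x)) => [k /eqP|h].
  by exists k.
pose s := x :: [seq ((k : nat)%:R : F) | k : 'I_p].
have p1 := prime_gt1 p_prime.
pose P : {poly F} := 'X^p - 'X.
have sz : size P = p.+1.
  by rewrite /P size_polyDl size_polyXn // size_polyN size_polyX.
have : (size s < size P)%N.
  apply: max_poly_roots.
  - by rewrite -size_poly_eq0 sz.
  - apply/allP => y; rewrite inE => /orP[/eqP ->|/mapP[k _ ->]].
      by rewrite rootE !hornerE xp subrr.
    by rewrite rootE !hornerE -(pFrobenius_autE hp) rmorph_nat subrr.
  - rewrite /= map_inj_uniq ?enum_uniq ?andbT.
      by apply/mapP => -[k _ e]; have := h k; rewrite e eqxx.
    move=> i j /eqP; rewrite natr_eq_mod !modn_small // => /eqP.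
    exact: val_inj.
by rewrite sz /= size_map -cardE card_ord ltnn.
Qed.

(** The trace is fixed by Frobenius, hence lies in the prime field, so the default value in
    [trace_nat] is never taken. *)
Lemma trace_natE x : (trace_nat p x)%:R = ftrace p x.
Proof.
rewrite /trace_nat; case: pickP => [k /eqP //|h].
by have [k hk] := frob_fixed (ftrace_frob x); have := h k; rewrite hk eqxx.
Qed.

(** As a polynomial in [x] the trace has degree [#|F| / p], too small for it to vanish on all of
    [F]. *)
Lemma ftrace_neq0 : exists x, ftrace p x != 0.
Proof.
case: (pickP (fun x => ftrace p x != 0)) => [x|h]; first by exists x.
pose n := (logn p #|F|).-1.
pose P : {poly F} := \sum_(i < n.+1) 'X^(p ^ i).
have nE : logn p #|F| = n.+1 by rewrite prednK // logn_card_gt0.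
have p1 := prime_gt1 p_prime.
have sz : size P = (p ^ n).+1.
  rewrite /P big_ord_recr /= addrC size_polyDl ?size_polyXn //.
  rewrite ltnS; apply: leq_trans (size_sum _ _ _) _.
  apply/bigmax_leqP => i _; by rewrite size_polyXn ltn_exp2l.
have : (size (enum F) < size P)%N.
  apply: max_poly_roots; last exact: enum_uniq.
    by rewrite -size_poly_eq0 sz.
  apply/allP => x _; have /negbFE/eqP := h x.
  rewrite rootE /ftrace nE horner_sum => {2}<-.
  by apply/eqP; apply: eq_bigr => i _; rewrite hornerXn.
by rewrite sz -cardE card_pchar nE ltnS leq_exp2l // ltnn.
Qed.

Lemma zeta_expr : zeta p ^+ p = 1.
Proof.
by rewrite /zeta -exprM mulnC exprM rootCK ?prime_gt0 // sqrrN expr1n.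
Qed.

Lemma zeta_neq1 : zeta p != 1.
Proof.
(* [zeta p = 1] would force the root to be [1], whose [p]-th power is not [-1], or [-1], whereas a
   principal root of order at least two is never negative. *)
rewrite /zeta sqrf_eq1 negb_or; apply/andP; split; apply/eqP => e.
  have := rootCK (prime_gt0 p_prime) (-1 : algC); rewrite e expr1n => /eqP.
  by rewrite -subr_eq0 opprK -(natrD _ 1 1) pnatr_eq0.
have := rootC_lt0 (-1 : algC) (prime_gt1 p_prime).
by rewrite e oppr_lt0 ltr01.
Qed.

Lemma zeta_expr_mod m n : m = n %[mod p] -> zeta p ^+ m = zeta p ^+ n.
Proof.
by move=> e; rewrite -(expr_mod m zeta_expr) e expr_mod // zeta_expr.
Qed.

Lemma zeta_expr_eq1 m : zeta p ^+ m = 1 -> (p %| m)%N.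
Proof.
move=> zm; apply: contraTT isT => /= ndvd.
have cop : coprime m p by rewrite coprime_sym prime_coprime.
have m0 : (0 < m)%N by case: m ndvd {zm cop} => //; rewrite dvdn0.
case: (egcdnP p m0) => km kn e _; have := zeta_neq1.
rewrite -{1}(expr1 (zeta p)) -(eqP cop) -[_ ^+ gcdn m p]mul1r.
rewrite -{1}(expr1n _ kn) -{1}zeta_expr -exprM -exprD mulnC -e mulnC exprM zm.
by rewrite expr1n eqxx.
Qed.

Definition trace_char x : algC := zeta p ^+ trace_nat p x.

Lemma trace_char_add : add_char trace_char.
Proof.
have D x y : trace_char (x + y) = trace_char x * trace_char y.
  rewrite -exprD; apply: zeta_expr_mod; apply/eqP.
  by rewrite -natr_eq_mod natrD !trace_natE ftraceD.
have E x : ftrace p x = 0 <-> trace_char x = 1.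
  split=> [t0|/zeta_expr_eq1].
    rewrite -[1](expr0 (zeta p)); apply: zeta_expr_mod; apply/eqP.
    by rewrite -natr_eq_mod trace_natE t0.
  by rewrite (dvdn_pcharf hp) trace_natE => /eqP.
have t0 : ftrace p (0 : F) = 0.
  by apply: (addrI (ftrace p 0)); rewrite -ftraceD !addr0.
split=> //; first exact/E.
have [a ta] := ftrace_neq0.
have : (trace_char a - 1) * \sum_x trace_char x = 0.
  rewrite mulrBl mul1r {2}(reindex_shift a) mulr_sumr -sumrB big1 // => x _.
  by rewrite D subrr.
move/eqP; rewrite mulf_eq0 subr_eq0 => /orP[/eqP/E t|/eqP //].
by rewrite t eqxx in ta.
Qed.

End TraceCharacter.

(** * Gauss sums and the period functions *)

Section GaussSums.
Variables (F : finFieldType) (psi : F -> algC).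
Hypothesis hpsi : add_char psi.
Implicit Types (X Y : F -> algC) (x y z t : F).

Local Notation q := (#|F|%:R : algC).

Lemma psi0 : psi 0 = 1. Proof. by case: hpsi. Qed.

Lemma psiD x y : psi (x + y) = psi x * psi y. Proof. by case: hpsi. Qed.

Lemma psi_conj x : (psi x)^* = psi (- x).
Proof.
have psiMn n : psi (x *+ n) = psi x ^+ n.
  elim: n => [|n IH]; first by rewrite mulr0n expr0 psi0.
  by rewrite mulrS exprS psiD IH.
have [p p_pr hp] := finPcharP F.
rewrite (conj_unity_root (prime_gt0 p_pr)); last first.
  by rewrite -psiMn -mulr_natr (pcharf0 hp) mulr0 psi0.
have : psi x * psi (- x) = 1 by rewrite -psiD subrr psi0.
by move=> h; apply: (mulfI (x := psi x)); rewrite ?h ?divff //;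
   apply: contra_eq_neq h => ->; rewrite mul0r eq_sym oner_eq0.
Qed.

Lemma card_neq0 : q != 0.
Proof. by rewrite pnatr_eq0 -lt0n card_field_gt0. Qed.

Lemma sum_psi_scale x : \sum_y psi (x * y) = q * (x == 0)%:R.
Proof.
have [->|x0] := eqVneq x 0; last first.
  by rewrite -reindex_scale // mulr0; case: hpsi.
under eq_bigr do rewrite mul0r psi0.
by rewrite sumr_const mulr1.
Qed.

Lemma sum_neq0 (f : F -> algC) : \sum_(y | y != 0) f y = \sum_y f y - f 0.
Proof. by rewrite [in RHS](bigD1 0) //= addrAC subrr add0r. Qed.

Lemma sum_psi_scale_neq0 x :
  \sum_(y | y != 0) psi (x * y) = q * (x == 0)%:R - 1.
Proof. by rewrite sum_neq0 sum_psi_scale mulr0 psi0. Qed.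

Definition gsum X := \sum_x X x * psi x.

(** The basic tool for trading a character of a shifted argument for an additive character.
    Nontriviality of [X] enters at [t = 0], where both sides are zero. *)
Lemma gsum_twist X t : mchar X -> X <> eps ->
  \sum_s X s * psi (s * t) = (X t)^-1 * gsum X.
Proof.
move=> hX nX; have [->|t0] := eqVneq t 0.
  under eq_bigr do rewrite mulr0 psi0 mulr1.
  by rewrite sum_mchar // mchar0 // invr0 mul0r.
rewrite /gsum [in RHS](reindex_scale _ t0) mulr_sumr.
apply: eq_bigr => s _; rewrite mcharM // mulrA mulKf ?mchar_neq0 //.
by rewrite [s * t]mulrC.
Qed.

(** Twisting the first sum by [y] and summing over [y] first leaves only [s = -1], by additive
    orthogonality. *)
Lemma gsum_mul_conj X : mchar X -> X <> eps ->
  gsum X * gsum (cconj X) = X (-1) * q.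
Proof.
move=> hX nX; rewrite {2}/gsum mulr_sumr.
transitivity (\sum_y \sum_s X s * psi ((s + 1) * y)).
  apply: eq_bigr => y _.
  rewrite cconjE // mulrA [gsum X * _]mulrC -gsum_twist // mulr_suml.
  by apply: eq_bigr => s _; rewrite -mulrA -psiD mulrDl mul1r.
rewrite exchange_big /=.
under eq_bigr do rewrite -mulr_sumr sum_psi_scale.
rewrite (bigD1 (-1)) //= addNr eqxx mulr1 big1 ?addr0 // => s.
by rewrite -subr_eq0 opprK => /negPf ->; rewrite !mulr0.
Qed.

Lemma gsum_eps : gsum eps = -1.
Proof.
rewrite /gsum (bigD1 0) //= mchar0; last exact: mchar_eps.
rewrite mul0r add0r (eq_bigr (fun y => psi (1 * y))) => [|y y0].
  by rewrite sum_psi_scale_neq0 oner_eq0 mulr0 sub0r.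
by rewrite /eps (negPf y0) !mul1r.
Qed.

Lemma gsum_neq0 X : mchar X -> gsum X != 0.
Proof.
move=> hX; have [->|nX] := excluded_middle_informative (X = eps).
  by rewrite gsum_eps oppr_eq0 oner_eq0.
have := gsum_mul_conj hX nX; apply: contra_eq_neq => ->.
rewrite mul0r eq_sym mulf_eq0 negb_or card_neq0 mchar_neq0 //.
by rewrite oppr_eq0 oner_eq0.
Qed.

(** Conjugate Gauss sums make this form valid also when [cmul X Y] is trivial, unlike the quotient
    [g(X) g(Y) / g(X Y)]. *)
Lemma jacobi_gsum X Y : mchar X -> mchar Y -> X <> eps -> Y <> eps ->
  jacobi X Y * gsum (cconj Y) = X (-1) * gsum X * gsum (cconj (cmul X Y)).
Proof.
move=> hX hY nX nY; rewrite /jacobi mulr_suml.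
have hY' := mchar_cconj hY; have nY' := cconj_neq_eps hY nY.
transitivity (\sum_x \sum_s X x * (cconj Y s * psi (s * (1 - x)))).
  apply: eq_bigr => x _; rewrite -mulr_sumr gsum_twist // cconjE // invrK.
  by rewrite mulrA.
rewrite exchange_big /= [gsum (cconj (cmul X Y))]/gsum mulr_sumr.
apply: eq_bigr => s _.
rewrite (cconjE s (mchar_cmul hX hY)) cmulE invfM.
have -> : X (-1) * gsum X * ((X s)^-1 * (Y s)^-1 * psi s) =
  cconj Y s * psi s * ((X (- s))^-1 * gsum X).
  rewrite cconjE // -[- s]mulN1r mcharM // invfM mcharN1V //.
  by ring.
rewrite -gsum_twist // mulr_sumr; apply: eq_bigr => x _.
rewrite mulrBr mulr1 psiD mulrN [x * s]mulrC; ring.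
Qed.

(* Up to a product of Gauss sums, this is [P32] after expanding the three
   characters of shifted arguments into additive characters; the terms in which
   some variable is zero vanish, since [0^-1 = 0]. *)
Definition hsum (A1 A2 A3 B1 B2 : F -> algC) (lam : F) : algC :=
  \sum_r \sum_s \sum_t \sum_y \sum_z
    A1 t * A2 y * A3 z * (B1 r)^-1 * (B2 s)^-1 *
      psi (t + y + z + r + s - lam * (t * y * z) / (r * s)).

Lemma P32_gsum A1 A2 A3 B1 B2 lam :
  mchar A1 -> mchar A2 -> mchar A3 -> mchar B1 -> mchar B2 ->
  A1 <> eps -> cmul B1 (cconj A2) <> eps -> cmul B2 (cconj A3) <> eps ->
  P32 A1 A2 A3 B1 B2 lam *
    (gsum A1 * gsum (cconj (cmul B1 (cconj A2)))
             * gsum (cconj (cmul B2 (cconj A3)))) =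
  A2 (-1) * A3 (-1) * hsum A1 A2 A3 B1 B2 lam.
Proof.
move=> hA1 hA2 hA3 hB1 hB2 nA1 nC1 nC2.
set C1 := cmul B1 _ in nC1 *; set C2 := cmul B2 _ in nC2 *.
have hC1 : mchar C1 by apply: mchar_cmul => //; apply: mchar_cconj.
have hC2 : mchar C2 by apply: mchar_cmul => //; apply: mchar_cconj.
have C1E x : C1 x = B1 x / A2 x by rewrite /C1 cmulE cconjE.
have C2E x : C2 x = B2 x / A3 x by rewrite /C2 cmulE cconjE.
(* [gsum_twist] replaces the three characters of [1 - lam z y], [1 - y], [1 - z] by additive sums in
   the variables [t], [r], [s]. *)
transitivity (\sum_r \sum_s \sum_t \sum_y \sum_z
    A3 z * A2 y * (A1 t * psi (t * (1 - lam * z * y))) *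
    (cconj C1 r * psi (r * (1 - y))) * (cconj C2 s * psi (s * (1 - z)))).
  have conv z y : A3 z * A2 y * C2 (1 - z) * C1 (1 - y)
      * (A1 (1 - lam * z * y))^-1
      * (gsum A1 * gsum (cconj C1) * gsum (cconj C2)) =
    \sum_r \sum_s \sum_t A3 z * A2 y * (A1 t * psi (t * (1 - lam * z * y))) *
    (cconj C1 r * psi (r * (1 - y))) * (cconj C2 s * psi (s * (1 - z))).
    under eq_bigr do under eq_bigr do rewrite -!mulr_suml -mulr_sumr.
    under eq_bigr do rewrite -mulr_sumr.
    rewrite -mulr_suml -mulr_sumr !gsum_twist //;
      try exact: mchar_cconj; try exact: cconj_neq_eps.
    by rewrite !cconjE // !invrK; ring.
  rewrite /P32 mulr_suml.
  transitivity (\sum_z \sum_y \sum_r \sum_s \sum_t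
    A3 z * A2 y * (A1 t * psi (t * (1 - lam * z * y))) *
    (cconj C1 r * psi (r * (1 - y))) * (cconj C2 s * psi (s * (1 - z)))).
    apply: eq_bigr => z _; rewrite /P21 mulr_sumr mulr_suml.
    apply: eq_bigr => y _; rewrite -conv /C1 /C2 !cmulE !cconjE //; ring.
  rewrite exchange_big /=.
  under eq_bigr do rewrite exchange_big /=.
  rewrite exchange_big /=; apply: eq_bigr => r _.
  under eq_bigr do rewrite exchange_big /=.
  rewrite exchange_big /=; apply: eq_bigr => s _.
  under eq_bigr do rewrite exchange_big /=.
  by rewrite exchange_big.
rewrite /hsum mulr_sumr; apply: eq_bigr => r _.
have [->|r0] := eqVneq r 0.
  rewrite !big1 ?mulr0 // => [s _|s _]; rewrite !big1 // => t _; rewrite !big1 // => y _;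
    rewrite !big1 // => z _; rewrite ?cconjE ?mchar0 // ?invr0 ?mulr0 ?mul0r ?mulr0 ?mul0r //.
rewrite mulr_sumr; apply: eq_bigr => s _.
have [->|s0] := eqVneq s 0.
  rewrite !big1 ?mulr0 // => [t _|t _]; rewrite !big1 // => y _;
    rewrite !big1 // => z _; rewrite ?cconjE ?mchar0 // ?invr0 ?mulr0 ?mul0r ?mulr0 ?mul0r //.
rewrite mulr_sumr; apply: eq_bigr => t _.
(* Replacing [y] by [- y / r] and [z] by [- z / s] turns the phases [r (1 - y)] and [s (1 - z)] into
   [r + y] and [s + z]; the signs give [A2 (-1) * A3 (-1)]. *)
have r0' : -1 / r != 0 by rewrite mulf_neq0 ?invr_eq0 // oppr_eq0 oner_eq0.
have s0' : -1 / s != 0 by rewrite mulf_neq0 ?invr_eq0 // oppr_eq0 oner_eq0.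
rewrite (reindex_scale _ r0') mulr_sumr; apply: eq_bigr => y _.
rewrite (reindex_scale _ s0') mulr_sumr; apply: eq_bigr => z _.
rewrite !cconjE // C1E C2E !(mcharM hA2) !(mcharM hA3) !(mcharV hA2) !(mcharV hA3).
have -> : t + y + z + r + s - lam * (t * y * z) / (r * s) =
  t * (1 - lam * (-1 / s * z) * (-1 / r * y)) + r * (1 - -1 / r * y) +
  s * (1 - -1 / s * z) by field; rewrite r0 s0.
rewrite !psiD; field.
by rewrite !mchar_neq0 // r0 s0.
Qed.

Lemma cconj_cmul_quotient X Y : mchar X -> mchar Y ->
  cconj (cmul X (cmul Y (cconj X))) = cconj Y.
Proof.
move=> hX hY; have hX' := mchar_cconj hX; have hYX := mchar_cmul hY hX'.
apply: eq_mchar; try by do ?[apply: mchar_cconj | apply: mchar_cmul].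
move=> x x0; rewrite !cconjE //; last exact: mchar_cmul.
by rewrite !cmulE cconjE // mulrCA divff ?mulr1 // mchar_neq0.
Qed.

Lemma jacobi_quotient X Y : mchar X -> mchar Y ->
  X <> eps -> cmul Y (cconj X) <> eps ->
  jacobi X (cmul Y (cconj X)) * gsum (cconj (cmul Y (cconj X))) =
  X (-1) * gsum X * gsum (cconj Y).
Proof.
move=> hX hY nX nYX; have hX' := mchar_cconj hX.
by rewrite jacobi_gsum // ?cconj_cmul_quotient //; apply: mchar_cmul.
Qed.

Lemma jacobi_quotient_neq0 X Y : mchar X -> mchar Y ->
  X <> eps -> cmul Y (cconj X) <> eps -> jacobi X (cmul Y (cconj X)) != 0.
Proof.
move=> hX hY nX nYX; have := jacobi_quotient hX hY nX nYX.
apply: contra_eq_neq => ->.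
rewrite mul0r eq_sym !mulf_neq0 ?gsum_neq0 ?mchar_neq0 ?oppr_eq0 ?oner_eq0 //.
exact: mchar_cconj.
Qed.

(** Rewriting the two Jacobi sums by [jacobi_quotient] cancels the signs and the Gauss sums of the
    quotients [B1 / A2] and [B2 / A3], leaving one Gauss sum per parameter. *)
Lemma F32_gsum A1 A2 A3 B1 B2 lam :
  mchar A1 -> mchar A2 -> mchar A3 -> mchar B1 -> mchar B2 ->
  A1 <> eps -> A2 <> eps -> A3 <> eps ->
  cmul B1 (cconj A2) <> eps -> cmul B2 (cconj A3) <> eps ->
  F32 A1 A2 A3 B1 B2 lam *
    (gsum A1 * gsum A2 * gsum A3 * gsum (cconj B1) * gsum (cconj B2)) =
  hsum A1 A2 A3 B1 B2 lam.
Proof.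
move=> hA1 hA2 hA3 hB1 hB2 nA1 nA2 nA3 nC1 nC2.
have hH := P32_gsum lam hA1 hA2 hA3 hB1 hB2 nA1 nC1 nC2.
have J1 := jacobi_quotient hA2 hB1 nA2 nC1.
have J2 := jacobi_quotient hA3 hB2 nA3 nC2.
have N1 := jacobi_quotient_neq0 hA2 hB1 nA2 nC1.
have N2 := jacobi_quotient_neq0 hA3 hB2 nA3 nC2.
have S2 := mcharN1 hA2; have S3 := mcharN1 hA3.
have -> : hsum A1 A2 A3 B1 B2 lam =
    A2 (-1) * A3 (-1) * (A2 (-1) * A3 (-1) * hsum A1 A2 A3 B1 B2 lam).
  by rewrite mulrA mulrACA S2 S3 !mul1r.
rewrite -hH /F32.
set g1 := gsum (cconj (cmul B1 _)) in J1 *.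
set g2 := gsum (cconj (cmul B2 _)) in J2 *.
set j1 := jacobi A2 _ in J1 N1 *; set j2 := jacobi A3 _ in J2 N2 *.
transitivity (P32 A1 A2 A3 B1 B2 lam / (j1 * j2) * gsum A1 *
  (A2 (-1) * A2 (-1) * gsum A2 * gsum (cconj B1)) *
  (A3 (-1) * A3 (-1) * gsum A3 * gsum (cconj B2))).
  by rewrite S2 S3 !mul1r; ring.
transitivity (P32 A1 A2 A3 B1 B2 lam / (j1 * j2) * gsum A1 *
  (A2 (-1) * (j1 * g1)) * (A3 (-1) * (j2 * g2))).
  by rewrite J1 J2; ring.
by field; rewrite N1 N2.
Qed.

(** At zero the double sum splits into the two normalizing Jacobi sums. This settles [x = 0], where
    the coefficient [U] of the ternary form would vanish. *)
Lemma F32_0 (A1 A2 A3 B1 B2 : F -> algC) :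
  mchar A1 -> mchar A2 -> mchar A3 -> mchar B1 -> mchar B2 ->
  A2 <> eps -> A3 <> eps ->
  cmul B1 (cconj A2) <> eps -> cmul B2 (cconj A3) <> eps ->
  F32 A1 A2 A3 B1 B2 0 = 1.
Proof.
move=> hA1 hA2 hA3 hB1 hB2 nA2 nA3 nC1 nC2.
have N1 := jacobi_quotient_neq0 hA2 hB1 nA2 nC1.
have N2 := jacobi_quotient_neq0 hA3 hB2 nA3 nC2.
rewrite /F32 -[RHS](divff (mulf_neq0 N1 N2)); congr (_ / _).
rewrite /P32 mulrC /jacobi mulr_suml; apply: eq_bigr => z _.
rewrite -[cmul (cconj A3) B2 _]mulrC; congr (_ * _).
apply: eq_bigr => y _; rewrite !mul0r subr0 cconjE // mchar1 // invr1 mulr1.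
by rewrite /cmul [cconj A2 _ * _]mulrC.
Qed.

End GaussSums.

(** * Quadratic character sums *)

Section QuadraticCharacter.
Variable F : finFieldType.
Hypothesis odd_card : odd #|F|.
Hypothesis two_neq0 : (2%:R : F) != 0.
Implicit Types (x y a b c : F).

Local Notation q := (#|F|%:R : algC).
Local Notation phi := (@qchar F).

Lemma natr4_neq0 : (4%:R : F) != 0.
Proof. by rewrite (_ : 4%:R = 2%:R * 2%:R :> F) ?mulf_neq0 // -natrM. Qed.

(** [#|F|.-1] is even, so the parity of an exponent of a generator is well defined; multiplicativity
    of [phi] follows from this formula. *)
Lemma qchar_prim_root (u : F) i :
  (#|F|.-1).-primitive_root u -> phi (u ^+ i) = (-1) ^+ i.
Proof.
move=> hu; have even_card : (2 %| #|F|.-1)%N.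
  by rewrite dvdn2 -subn1 oddB ?card_field_gt0 // odd_card.
have u0 := prim_root_neq0 hu.
rewrite /qchar expf_eq0 (negPf u0) andbF -signr_odd.
case: existsP => [[y /eqP yi]|h].
  have y0 : y != 0.
    by apply: contra_neq (expf_neq0 i u0) => y0; rewrite -yi y0 expr0n.
  have [j yj] := prim_rootP hu (expf_card_pred y0).
  move/eqP: yi; rewrite yj -exprM (eq_prim_root_expr hu) => /eqP e.
  have : (i %% 2 = (j * 2) %% 2)%N.
    by rewrite -(modn_dvdm i even_card) -e modn_dvdm.
  by rewrite modnMl modn2; case: (odd i).
case oi: (odd i) => //; case: h; exists (u ^+ i./2).
by rewrite -exprM muln2 -[X in _ == u ^+ X](odd_double_half i) oi.
Qed.

Lemma mchar_qchar : mchar phi.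
Proof.
have [u hu] := finField_prim_root F.
have h x : x != 0 -> exists i, x = u ^+ i.
  by move=> /expf_card_pred /(prim_rootP hu)[i ->]; exists i.
split; first by rewrite /qchar eqxx.
  by rewrite -(expr0 u) qchar_prim_root.
move=> x y /h[i ->] /h[j ->].
by rewrite -exprD !qchar_prim_root // exprD.
Qed.

Lemma qchar_neq_eps : phi <> eps.
Proof.
have [u hu] := finField_prim_root F.
move/(congr1 (fun f => f u)); rewrite -{1}(expr1 u) qchar_prim_root // expr1.
rewrite /eps; case: eqP => _ /eqP; first by rewrite oppr_eq0 oner_eq0.
by rewrite eq_sym -subr_eq0 opprK -(natrD _ 1 1) pnatr_eq0.
Qed.

Lemma qchar_sqr x : x != 0 -> phi (x ^+ 2) = 1.
Proof.
move=> x0; rewrite /qchar expf_eq0 (negPf x0) andbF.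
by case: existsP => // -[]; exists x.
Qed.

Lemma qcharK x : x != 0 -> phi x * phi x = 1.
Proof. by move=> x0; rewrite -expr2 -(mcharX mchar_qchar) qchar_sqr. Qed.

Lemma qcharV x : (phi x)^-1 = phi x.
Proof.
have [->|x0] := eqVneq x 0; first by rewrite (mchar0 mchar_qchar) invr0.
have n0 : phi x != 0 by rewrite (mchar_neq0 mchar_qchar).
by apply: (mulfI n0); rewrite qcharK // divff.
Qed.

Lemma sum_sqr_eq y : \sum_a ((a ^+ 2 == y)%:R : algC) = 1 + phi y.
Proof.
have [->|y0] := eqVneq y 0.
  rewrite (mchar0 mchar_qchar) addr0 (bigD1 0) //= expr0n eqxx big1 ?addr0 //.
  by move=> a a0; rewrite expf_eq0 (negPf a0).
rewrite /qchar (negPf y0); case: existsP => [[b /eqP bE]|h]; last first.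
  by rewrite subrr big1 // => a _; case: eqP => // ay; case: h; exists a; rewrite ay.
have b0 : b != 0 by apply: contra_neq y0 => b0; rewrite -bE b0 expr0n.
have nb : - b != b.
  by rewrite -subr_eq0 -opprD oppr_eq0 -mulr2n -mulr_natl mulf_neq0.
rewrite (bigD1 b) //= bE eqxx (bigD1 (- b)) //= sqrrN bE eqxx big1 ?addr0 //.
move=> a /andP[ab anb]; rewrite -bE -subr_eq0 subr_sqr mulf_eq0 subr_eq0.
by rewrite (negPf ab) addr_eq0 (negPf anb).
Qed.

Lemma sum_sqr (f : F -> algC) : \sum_a f (a ^+ 2) = \sum_y (1 + phi y) * f y.
Proof.
under [RHS]eq_bigr do rewrite -sum_sqr_eq mulr_suml.
rewrite exchange_big; apply: eq_bigr => a _.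
rewrite (bigD1 (a ^+ 2)) //= eqxx mul1r big1 ?addr0 // => y ne.
by rewrite eq_sym (negPf ne) mul0r.
Qed.

(** Squares are counted by [1 + phi]; for [y != 0] the product [phi y * phi (y + c)] equals
    [phi (1 + c / y)], and inversion makes the remaining sum affine. *)
Lemma sum_qchar_sqr_add c :
  \sum_a phi (a ^+ 2 + c) = q * (c == 0)%:R - 1.
Proof.
have hphi := mchar_qchar.
rewrite (sum_sqr (fun y => phi (y + c))).
under eq_bigr do rewrite mulrDl mul1r.
have s0 : \sum_y phi y = 0 by apply: sum_mchar => //; exact: qchar_neq_eps.
rewrite big_split /=.
have -> : \sum_y phi (y + c) = 0.
  by rewrite -[RHS]s0 (reindex_shift c); apply: eq_bigr => y _; rewrite addrC.
rewrite add0r (bigD1 0) //= mchar0 // mul0r add0r.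
transitivity (\sum_(y | y != 0) phi (1 + c * y^-1)).
  apply: eq_bigr => y y0; rewrite -mcharM //.
  have -> : y * (y + c) = y ^+ 2 * (1 + c * y^-1) by field.
  by rewrite mcharM // qchar_sqr // mul1r.
rewrite sum_neq0 -(reindex_inv (fun y => phi (1 + c * y))) invr0 mulr0 addr0.
rewrite mchar1 //; congr (_ - 1); have [->|c0] := eqVneq c 0.
  under eq_bigr do rewrite mul0r addr0 mchar1 //.
  by rewrite sumr_const mulr1.
by rewrite -(reindex_scale (fun y => phi (1 + y)) c0) -reindex_shift s0 mulr0.
Qed.

Lemma reindex_affine (l m : F) (f : F -> algC) :
  l != 0 -> \sum_b f (l * b + m) = \sum_b f b.
Proof.
move=> l0; rewrite [RHS](reindex_shift m) [RHS](reindex_scale _ l0).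
by apply: eq_bigr => b _; rewrite addrC.
Qed.

(** If [l != 0], completing the square leaves [1 + phi ((m^2 - l n) c^2)] values of [b] for each
    [c]. If [l = 0], the line [c = 0] contributes [q], and for each [c != 0] the equation has one
    solution [b] or none, according as [m] is nonzero or zero. *)
Lemma binary_form_zeros (l m n : F) : ~~ [&& l == 0, m == 0 & n == 0] ->
  \sum_b \sum_c ((l * b ^+ 2 + 2%:R * m * b * c + n * c ^+ 2 == 0)%:R : algC)
  = q + (q - 1) * phi (m ^+ 2 - l * n).
Proof.
have hphi := mchar_qchar.
have sumsq : \sum_c phi (c ^+ 2) = q - 1.
  by under eq_bigr do rewrite -[_ ^+ 2]addr0; rewrite sum_qchar_sqr_add eqxx mulr1.
have [->|l0] := eqVneq l 0; last first.
  move=> _; rewrite exchange_big /=.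
  transitivity (\sum_c (1 + phi ((m ^+ 2 - l * n) * c ^+ 2))).
    apply: eq_bigr => c _; rewrite -sum_sqr_eq.
    rewrite -(reindex_affine (m * c) (fun b => (b ^+ 2 == _)%:R) l0).
    apply: eq_bigr => b _; congr (nat_of_bool _)%:R.
    rewrite -(inj_eq (mulfI l0)) mulr0 -[RHS]subr_eq0; congr (_ == 0); ring.
  rewrite big_split /= sumr_const; congr (_ + _).
  by under eq_bigr do rewrite mcharM //; rewrite -mulr_sumr sumsq mulrC.
rewrite /= mul0r subr0 exchange_big (bigD1 0) //=.
rewrite (eq_bigr (fun=> 1)) => [|b _]; last first.
  by rewrite mul0r mulr0 expr0n mulr0 !addr0 eqxx.
rewrite sumr_const => mn; congr (_ + _).
transitivity (\sum_(c : F | c != 0) phi (m ^+ 2)); last first.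
  by rewrite sumr_const cardC1 -subn1 -[LHS]mulr_natl natrB ?card_field_gt0.
apply: eq_bigr => c c0; have [m0|m0] := eqVneq m 0.
  rewrite m0 expr0n mchar0 // big1 // => b _.
  rewrite mul0r mulr0 !mul0r !add0r mulf_eq0 expf_eq0 (negPf c0) andbF orbF.
  by move: mn; rewrite m0 eqxx /= => /negPf ->.
rewrite qchar_sqr // (bigD1 (- n * c / (2%:R * m))) //= big1 ?addr0.
  have -> : 0 * (- n * c / (2%:R * m)) ^+ 2 +
    2%:R * m * (- n * c / (2%:R * m)) * c + n * c ^+ 2 = 0.
    by field; rewrite two_neq0 m0.
  by rewrite eqxx.
move=> b; case: (eqVneq (_ + _ + _) 0) => // e /eqP[]; apply: (mulfI c0).
apply: (mulfI (mulf_neq0 two_neq0 m0)); apply/eqP; rewrite -subr_eq0 -e.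
by apply/eqP; field; rewrite two_neq0 m0.
Qed.

(** After multiplication by [4 V] and completion of the square, each [c] contributes [q - 1] if
    [(4 V W - 1) c^2 = 0] and [-1] otherwise, up to [phi V]; unless [4 V W = 1] these contributions
    cancel. *)
Lemma sum_qchar_binary (V W : F) : V != 0 ->
  \sum_b \sum_c phi (V * b ^+ 2 + b * c + W * c ^+ 2)
  = (4%:R * V * W == 1)%:R * (q * (q - 1) * phi V).
Proof.
move=> V0; have hphi := mchar_qchar; rewrite exchange_big /=.
have V20 : 2%:R * V != 0 by rewrite mulf_neq0.
transitivity (\sum_c phi V * (q * ((4%:R * V * W - 1) * c ^+ 2 == 0)%:R - 1)).
  apply: eq_bigr => c _; rewrite -sum_qchar_sqr_add.
  rewrite -(reindex_affine c (fun b => phi (b ^+ 2 + _)) V20) mulr_sumr.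
  apply: eq_bigr => b _.
  have -> : (2%:R * V * b + c) ^+ 2 + (4%:R * V * W - 1) * c ^+ 2 =
    2%:R ^+ 2 * V * (V * b ^+ 2 + b * c + W * c ^+ 2) by ring.
  rewrite mcharM // [phi (_ * V)]mcharM // qchar_sqr //.
  by rewrite mul1r mulrA qcharK // mul1r.
rewrite -mulr_sumr mulrC sumrB sum_const -mulr_sumr.
have [e|ne] := eqVneq (4%:R * V * W) 1.
  under eq_bigr do rewrite e subrr mul0r eqxx.
  by rewrite sum_const !mulr1 mul1r; ring.
rewrite mul0r (bigD1 0) //= expr0n mulr0 eqxx big1 => [|c c0].
  by rewrite addr0 !mulr1 subrr mul0r.
by rewrite mulf_eq0 subr_eq0 (negPf ne) expf_eq0 (negPf c0).
Qed.

Lemma sum_qchar_ternary (U V W : F) : U != 0 ->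
  \sum_a \sum_b \sum_c
    phi (U * a ^+ 2 + V * b ^+ 2 + W * c ^+ 2 + a * b + b * c + c * a)
  = q * (q - 1) * phi (- (1 - U - V - W + 4%:R * U * V * W))
    + [&& U == 2%:R^-1, V == 2%:R^-1 & W == 2%:R^-1]%:R
      * (q ^+ 2 * (q - 1) * phi 2%:R).
Proof.
move=> U0; have hphi := mchar_qchar.
have U20 : 2%:R * U != 0 by rewrite mulf_neq0.
(* With [f] the form, [4 U f = (2 U a + b + c)^2 + l b^2 + 2 m b c + n c^2]: the sum over [a]
   reduces the problem to counting zeros of the residual binary form. *)
pose l := 4%:R * U * V - 1; pose m := 2%:R * U - 1; pose n := 4%:R * U * W - 1.
transitivity (phi U * (q * (\sum_b \sum_c
  ((l * b ^+ 2 + 2%:R * m * b * c + n * c ^+ 2 == 0)%:R : algC)) - q * q)).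
  rewrite exchange_big /=; under eq_bigr do rewrite exchange_big /=.
  transitivity (\sum_b \sum_c phi U * (q * (l * b ^+ 2 + 2%:R * m * b * c + n * c ^+ 2 == 0)%:R - 1)).
    apply: eq_bigr => b _; apply: eq_bigr => c _; rewrite -sum_qchar_sqr_add.
    rewrite -(reindex_affine (b + c) (fun b => phi (b ^+ 2 + _)) U20) mulr_sumr.
    apply: eq_bigr => a _.
    have -> : (2%:R * U * a + (b + c)) ^+ 2 +
        (l * b ^+ 2 + 2%:R * m * b * c + n * c ^+ 2) =
      2%:R ^+ 2 * U *
        (U * a ^+ 2 + V * b ^+ 2 + W * c ^+ 2 + a * b + b * c + c * a).
      by rewrite /l /m /n; ring.
    rewrite mcharM // [phi (_ * U)]mcharM // qchar_sqr //.
    by rewrite mul1r mulrA qcharK // mul1r.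
  rewrite [in RHS]mulr_sumr -[X in _ - X]sum_const -sumrB mulr_sumr.
  apply: eq_bigr => b _; rewrite -mulr_sumr; congr (_ * _).
  by rewrite mulr_sumr sumrB sum_const mulr1.
have degE : [&& l == 0, m == 0 & n == 0] =
    [&& U == 2%:R^-1, V == 2%:R^-1 & W == 2%:R^-1].
  have mE : (m == 0) = (U == 2%:R^-1).
    by rewrite -[RHS](inj_eq (mulfI two_neq0)) divff // /m subr_eq0.
  rewrite andbCA mE; case: (eqVneq U) => //= UE.
  have E Z : (4%:R * U * Z - 1 == 0) = (Z == 2%:R^-1).
    rewrite -[RHS](inj_eq (mulfI two_neq0)) divff // subr_eq0 UE.
    by congr (_ == _); field.
  by rewrite /l /n !E.
(* The residual form vanishes identically exactly when [U = V = W = 1/2], where the ternary form is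
   half the square of [a + b + c]. *)
case deg: [&& U == _, V == _ & W == _].
  case/and3P: deg => /eqP UE /eqP VE /eqP WE.
  have -> : 1 - U - V - W + 4%:R * U * V * W = 0.
    by rewrite UE VE WE; field.
  rewrite oppr0 mchar0 // mulr0 add0r mul1r.
  have /and3P[/eqP -> /eqP -> /eqP ->] : [&& l == 0, m == 0 & n == 0].
    by rewrite degE UE VE WE !eqxx.
  under eq_bigr do under eq_bigr do rewrite mulr0 !mul0r !addr0 eqxx.
  under eq_bigr do rewrite sum_const.
  by rewrite sum_const mulr1 UE mcharV // qcharV; ring.
rewrite binary_form_zeros ?degE ?deg // mul0r addr0.
have -> : m ^+ 2 - l * n =
  2%:R ^+ 2 * U * (- (1 - U - V - W + 4%:R * U * V * W)).
  by rewrite /l /m /n; ring.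
rewrite mcharM // [phi (_ * U)]mcharM // qchar_sqr // mul1r.
transitivity (q * (q - 1) * (phi U * phi U) *
  phi (- (1 - U - V - W + 4%:R * U * V * W))); first by ring.
by rewrite qcharK // mulr1.
Qed.

End QuadraticCharacter.

(** * The Hasse-Davenport relation for cubic characters *)

Section CubicCharacter.
Variables (F : finFieldType) (psi : F -> algC).
Hypothesis hpsi : add_char psi.
Hypothesis three_dvd : (3 %| #|F|.-1)%N.
Hypothesis three_neq0 : (3%:R : F) != 0.
Implicit Types (x y z m n k a b t : F).

Local Notation q := (#|F|%:R : algC).

Lemma exists_cube_root1 : exists om : F, om ^+ 2 + om + 1 = 0.
Proof.
have [u hu] := finField_prim_root F.
pose om := u ^+ (#|F|.-1 %/ 3); exists om.
have om3 : om ^+ 3 = 1 by rewrite -exprM divnK // prim_expr_order.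
have om1 : om != 1.
  rewrite -(expr0 u) (eq_prim_root_expr hu) mod0n.
  have d0 : (0 < #|F|.-1 %/ 3)%N by rewrite divn_gt0 // dvdn_leq // card_pred_gt0.
  by rewrite modn_small -?lt0n // ltn_Pdiv // card_pred_gt0.
apply: (mulfI (x := om - 1)); first by rewrite subr_eq0.
by rewrite mulr0; transitivity (om ^+ 3 - 1); [ring | rewrite om3 subrr].
Qed.

Section CubicGaussSum.
Variable om : F.
Hypothesis omE : om ^+ 2 + om + 1 = 0.

(** The other root [om ^+ 2] of [X^2 + X + 1], written linearly in [om]. *)
Let om2 := -1 - om.

Lemma cubeE x n : (x ^+ 3 == n ^+ 3) = [|| x == n, x == om * n | x == om2 * n].
Proof.
rewrite -3![x == _]subr_eq0 orbA -!mulf_eq0 -[LHS]subr_eq0; congr (_ == 0).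
transitivity ((x - n) * (x - om * n) * (x - om2 * n)
  + (x - n) * n ^+ 2 * (om ^+ 2 + om + 1)); first by rewrite /om2; ring.
by rewrite omE mulr0 addr0.
Qed.

Lemma om_neq : [/\ om != 0, om != 1, om != -1, om2 != 1 & om2 != om].
Proof.
have N c : om = c -> c ^+ 2 + c + 1 = 0 by move=> <-.
(* The discriminant of [X^2 + X + 1] is [-3], so equal roots would force [3 = 0]. *)
have half : om2 == om -> 3%:R = 0 :> F.
  move/eqP => e; transitivity ((om2 - om) * (2%:R * om + 1) + 4%:R * (om ^+ 2 + om + 1)).
    by rewrite /om2; ring.
  by rewrite e subrr mul0r omE mulr0 addr0.
split; apply/eqP.
- by move/N/eqP; rewrite expr0n !add0r oner_eq0.
- move/N; rewrite expr1n -(natrD _ 1 1) -(natrD _ 2 1) => /eqP.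
  by rewrite (negPf three_neq0).
- by move/N/eqP; rewrite sqrrN expr1n subrr add0r oner_eq0.
- move=> e; have /N : om = - 2%:R.
    by transitivity (-1 - om2); [rewrite /om2; ring | rewrite e; ring].
  by move=> h; case/eqP: three_neq0; rewrite -h; ring.
- by move/eqP/half/eqP; rewrite (negPf three_neq0).
Qed.

Lemma om2_neq0 : om2 != 0.
Proof.
have [_ _ m1 _ _] := om_neq; apply: contra_neq m1 => e.
by transitivity (-1 - om2); [rewrite /om2; ring | rewrite e subr0].
Qed.

Lemma om2_neqN1 : om2 != -1.
Proof.
have [m0 _ _ _ _] := om_neq; apply: contra_neq m0 => e.
by transitivity (-1 - om2); [rewrite /om2; ring | rewrite e subrr].
Qed.

Lemma reindex_scale_neq0 (c : F) (f : F -> algC) : c != 0 ->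
  \sum_(y | y != 0) f y = \sum_(y | y != 0) f (c * y).
Proof.
move=> c0; rewrite (reindex_inj (mulfI c0)); apply: eq_bigl => y.
by rewrite mulf_eq0 (negPf c0).
Qed.

Variable eta : F -> algC.
Hypothesis heta : mchar eta.
Hypothesis eta3 : cexp eta 3 = eps.
Hypothesis eta_neq : eta <> eps.

Lemma eta_cube x : x != 0 -> eta x ^+ 3 = 1.
Proof.
by move=> x0; have := congr1 (fun f => f x) eta3; rewrite cexpE /eps (negPf x0).
Qed.

(* The cubic [y + z + 1 / (y z) = 3] has a node at [(1, 1)]; the lines through
   it parametrize the curve in such a way that [y / z] becomes a cube. *)
Definition nodal_set : {set F * F} :=
  [set yz | [&& yz.1 != 0, yz.2 != 0 & yz.1 + yz.2 + (yz.1 * yz.2)^-1 == 3%:R]].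

(** The remaining intersection of the cubic with the line of slope [k = (z - 1) / (y - 1)] through
    the node; there [y / z = k^-3]. *)
Definition nodal_param k : F * F := (- (k * (1 + k))^-1, - k ^+ 2 / (1 + k)).

(** The slopes [0] and [-1] lead to infinity; [om] and [om2] are the tangent directions at the node,
    which lead back to [(1, 1)]. *)
Definition nodal_slopes : {set F} := ~: [set 0; -1; om; om2].

Lemma nodal_slopesP k :
  k \in nodal_slopes -> [/\ k != 0, 1 + k != 0 & k ^+ 2 + k + 1 != 0].
Proof.
rewrite !inE !negb_or => /andP[/andP[/andP[k0 k1] ko] ko2]; split=> //.
  by move: k1; rewrite -subr_eq0 opprK addrC.
suff -> : k ^+ 2 + k + 1 = (k - om) * (k - om2).
  by rewrite mulf_neq0 // subr_eq0.
transitivity ((k - om) * (k - om2) + (om ^+ 2 + om + 1)); last by rewrite omE addr0.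
by rewrite /om2; ring.
Qed.

Lemma nodal_setE : nodal_set = (1, 1) |: nodal_param @: nodal_slopes.
Proof.
apply/setP => -[y z]; rewrite in_setU1; apply/idP/idP; last first.
  case/orP => [/eqP -> | /imsetP[k /nodal_slopesP[k0 k1 k2] ->]].
    by rewrite inE /= oner_eq0 mulr1 invr1 /=; apply/eqP; ring.
  rewrite inE /=; apply/and3P; split.
  - by rewrite oppr_eq0 invr_eq0 mulf_neq0.
  - by rewrite mulf_neq0 ?invr_eq0 // oppr_eq0 expf_neq0.
  - by apply/eqP; field; rewrite k0 k1 ?oppr_eq0 ?oner_eq0 ?expf_neq0.
rewrite inE /= => /and3P[y0 z0 /eqP e].
have [//|ne] /= := eqVneq (y, z) (1, 1).
(* The equation of the cubic in coordinates centred at the node, with its cubic and quadratic parts;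
   in particular [y = 1] forces [z = 1]. *)
have E : (y - 1) * (z - 1) * (y - 1 + (z - 1)) + (y - 1) ^+ 2
    + (y - 1) * (z - 1) + (z - 1) ^+ 2 = 0.
  transitivity (y * z * (y + z + (y * z)^-1 - 3%:R)); last by rewrite e subrr mulr0.
  by field; rewrite y0 z0.
have y1 : y - 1 != 0.
  apply: contra_neq ne => y1; move: E; rewrite y1 !mul0r expr0n !add0r => /eqP.
  rewrite expf_eq0 /= => /eqP z1.
  by rewrite -[y](subrK 1) -[z](subrK 1) y1 z1 add0r.
pose k := (z - 1) / (y - 1).
have yk : y * (k * (1 + k)) = -1.
  apply/eqP; rewrite -subr_eq0 opprK.
  suff -> : y * (k * (1 + k)) + 1 = ((y - 1) * (z - 1) * (y - 1 + (z - 1)) + (y - 1) ^+ 2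
    + (y - 1) * (z - 1) + (z - 1) ^+ 2) / (y - 1) ^+ 2 by rewrite E mul0r.
  by rewrite /k; field.
have zk : z * (1 + k) = - k ^+ 2.
  apply/eqP; rewrite -subr_eq0 opprK.
  suff -> : z * (1 + k) + k ^+ 2 = ((y - 1) * (z - 1) * (y - 1 + (z - 1)) + (y - 1) ^+ 2
    + (y - 1) * (z - 1) + (z - 1) ^+ 2) / (y - 1) ^+ 2 by rewrite E mul0r.
  by rewrite /k; field.
have : k * (1 + k) != 0.
  by apply: contra_eq_neq yk => ->; rewrite mulr0 eq_sym oppr_eq0 oner_eq0.
rewrite mulf_eq0 negb_or => /andP[k0 k1].
apply/imsetP; exists k; last first.
  by rewrite /nodal_param -zk mulfK // -[y](mulfK (mulf_neq0 k0 k1)) yk mulN1r.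
have kk : k * (1 + k) != -1.
  apply: contra_neq y1 => kk; move: yk; rewrite kk mulrN1 => /oppr_inj ->.
  by rewrite subrr.
rewrite !inE !negb_or k0 /=; apply/andP; split; first (apply/andP; split).
- by apply: contra_neq k1 => ->; rewrite subrr.
- apply: contra_neq kk => ->; apply/eqP; rewrite -subr_eq0 opprK -omE.
  by apply/eqP; ring.
- apply: contra_neq kk => ->; apply/eqP; rewrite -subr_eq0 opprK -omE /om2.
  by apply/eqP; ring.
Qed.

Lemma card_nodal_slopes : (#|nodal_slopes| + 4)%N = #|F|.
Proof.
have [m0 _ mN1 _ m2] := om_neq.
rewrite /nodal_slopes -(cardsC [set 0; -1; om; om2]) addnC; congr (_ + _)%N.
rewrite -!setUA !cardsU1 cards1 !inE !negb_or.
rewrite ![0 == _]eq_sym ![-1 == _]eq_sym [om == om2]eq_sym.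
have -> : (0 : F) != -1 by rewrite eq_sym oppr_eq0 oner_eq0.
by rewrite m0 om2_neq0 mN1 om2_neqN1 m2.
Qed.

Lemma card_nodal_set : #|nodal_set|%:R = q - 3%:R.
Proof.
rewrite nodal_setE cardsU1 card_in_imset => [|k k' /nodal_slopesP[k0 k1 k2] /nodal_slopesP[k0' k1' k2'] []].
  have -> : (1, 1) \notin nodal_param @: nodal_slopes.
    apply/imsetP => -[k /nodal_slopesP[k0 k1 k2] [e _]].
    case/eqP: k2; transitivity (k * (1 + k) * (1 - - (k * (1 + k))^-1)).
      by field; rewrite k0 k1.
    by rewrite -e subrr mulr0.
  have := congr1 (fun i : nat => i%:R : algC) card_nodal_slopes.
  by rewrite natrD => <-; rewrite add1n -natr1; ring.
move=> e1 e2.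
have P (j : F) : j != 0 -> 1 + j != 0 -> j ^+ 2 + j + 1 != 0 ->
    j = (- j ^+ 2 / (1 + j) - 1) / (- (j * (1 + j))^-1 - 1).
  move=> j0 j1 j2; field; rewrite j1 j0 /=.
  suff -> : -1 + -1 * (j * (1 + j)) = - (j ^+ 2 + j + 1) by rewrite oppr_eq0.
  by ring.
by rewrite (P k) // (P k') // e1 e2.
Qed.

(** Away from the node [y / z] is the cube [k^-3], and at the node it is [1]; so the character
    factor is [1] on the whole curve, and the sum counts [q - 4] slopes and the node. *)
Lemma nodal_sum :
  \sum_(y | y != 0) \sum_(z | z != 0)
    eta y / eta z * (y + z + (y * z)^-1 == 3%:R)%:R = q - 3%:R.
Proof.
rewrite -card_nodal_set pair_big_dep /= -sum1_card natr_sum.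
rewrite big_mkcond [RHS]big_mkcond; apply: eq_bigr => -[y z] _ /=.
rewrite inE /=; case: eqVneq => //= y0; case: eqVneq => //= z0.
case: eqVneq => //= e; last by rewrite mulr0.
have : (y, z) \in nodal_set by rewrite inE /= y0 z0 e eqxx.
rewrite nodal_setE in_setU1 mulr1 => /orP[/eqP[-> ->]|].
  by rewrite divff // mchar_neq0 // oner_eq0.
case/imsetP=> k /nodal_slopesP[k0 k1 _] [yE zE].
have -> : eta y / eta z = eta (k^-1 ^+ 3).
  rewrite -mcharV // -mcharM // yE zE; congr (eta _); field.
  by rewrite k0 k1 oppr_eq0 expf_neq0.
by rewrite mcharX // eta_cube // invr_eq0.
Qed.

(* [kfun] is the multiplicative convolution whose Mellin transform at [X] is
   [g(X) g(X eta) g(X / eta)]; that of [kfun0] is [g(X^3) / X^3(3)]. *)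
Definition kfun m : algC :=
  \sum_(y | y != 0) \sum_(z | z != 0) eta y / eta z * psi (y + z + m / (y * z)).

Definition kfun0 m : algC := \sum_n (n ^+ 3 == m)%:R * psi (3%:R * n).

Lemma sum_kfun0 (f : F -> algC) :
  \sum_(m | m != 0) f m * kfun0 m =
  \sum_(n | n != 0) f (n ^+ 3) * psi (3%:R * n).
Proof.
under eq_bigr do rewrite mulr_sumr.
rewrite exchange_big /= [RHS]big_mkcond; apply: eq_bigr => n _ /=.
have [->|n0] := eqVneq n 0.
  by rewrite big1 // => m m0; rewrite expr0n eq_sym (negPf m0) mul0r mulr0.
rewrite (bigD1 (n ^+ 3)) ?expf_neq0 //= eqxx mul1r big1 ?addr0 // => m.
by case/andP=> _ ne; rewrite eq_sym (negPf ne) mul0r mulr0.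
Qed.

Lemma kfun0_cube n : n != 0 ->
  kfun0 (n ^+ 3) = psi (3%:R * n) + psi (3%:R * (om * n)) + psi (3%:R * (om2 * n)).
Proof.
move=> n0; have [m0 m1 _ m21 m2] := om_neq.
have omn a b : a != b -> a * n != b * n by rewrite (inj_eq (mulIf n0)).
have n1 : om * n != n by rewrite -[X in _ != X]mul1r omn.
have n2 : om2 * n != n by rewrite -[X in _ != X]mul1r omn.
rewrite /kfun0 (bigD1 n) //= (bigD1 (om * n)) //= (bigD1 (om2 * n)) /=; last first.
  by rewrite n2 omn.
rewrite !cubeE !eqxx !orbT /= !mul1r !addrA big1 ?addr0 // => x.
by case/andP=> /andP[a b] c; rewrite cubeE (negPf a) (negPf b) (negPf c) mul0r.
Qed.

(** At a cube [n^3] the conjugate has three terms, with phases [-3 n], [-3 om n], [-3 om2 n];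
    against [psi (3 n)] the first sums to [q - 1] and each of the others to [-1]. *)
Lemma norm_kfun0 : \sum_(m | m != 0) kfun0 m * (kfun0 m)^* = q - 3%:R.
Proof.
have [m0 m1 _ m21 m2] := om_neq.
under eq_bigr do rewrite mulrC.
rewrite (sum_kfun0 (fun m => (kfun0 m)^*)).
transitivity (\sum_(n | n != 0) (1 + psi (3%:R * (1 - om) * n)
   + psi (3%:R * (1 - om2) * n))).
  apply: eq_bigr => n n0; rewrite kfun0_cube // !rmorphD /= !psi_conj //.
  rewrite [X in X = _]mulrDl [X in X + _ = _]mulrDl -!(psiD hpsi) addNr psi0 //.
  by congr (_ + psi _ + psi _); rewrite ?/om2; ring.
rewrite !big_split /= !sum_psi_scale_neq0 // !mulf_eq0 (negPf three_neq0) !subr_eq0.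
rewrite ![1 == _]eq_sym (negPf m1) (negPf m21) /= mulr0 sum_neq0 sum_const; ring.
Qed.

(** With [m = n^3] and [y], [z] scaled by [n], the phase becomes [n (y + z + 1 / (y z) - 3)], so the
    sum over [n] detects the points of the nodal cubic. *)
Lemma inner_kfun : \sum_(m | m != 0) kfun m * (kfun0 m)^* = q * (q - 3%:R).
Proof.
rewrite -[LHS]conjCK rmorph_sum.
under eq_bigr do rewrite rmorphM /= conjCK.
rewrite (sum_kfun0 (fun m => (kfun m)^*)) rmorph_sum.
transitivity (\sum_(n | n != 0) \sum_(y | y != 0) \sum_(z | z != 0)
   eta y / eta z * psi ((y + z + (y * z)^-1 - 3%:R) * n)).
  apply: eq_bigr => n n0; rewrite rmorphM /= conjCK psi_conj // /kfun mulr_suml.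
  rewrite (reindex_scale_neq0 _ n0); apply: eq_bigr => y y0.
  rewrite mulr_suml (reindex_scale_neq0 _ n0); apply: eq_bigr => z z0.
  rewrite -[LHS]mulrA -(psiD hpsi) !(mcharM heta) -mulf_div divff ?mchar_neq0 // mul1r.
  by congr (_ * psi _); field; rewrite n0 y0 z0.
rewrite exchange_big /=; under eq_bigr do rewrite exchange_big /=.
transitivity (\sum_(y | y != 0) \sum_(z | z != 0)
  (q * (eta y / eta z * (y + z + (y * z)^-1 == 3%:R)%:R) - eta y / eta z)).
  apply: eq_bigr => y y0; apply: eq_bigr => z z0.
  rewrite -mulr_sumr sum_psi_scale_neq0 // subr_eq0; ring.
under eq_bigr do rewrite sumrB -mulr_sumr.
rewrite sumrB -mulr_sumr nodal_sum.
rewrite [X in _ - X](_ : _ = 0) ?subr0 // exchange_big big1 //= => z z0.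
by rewrite -mulr_suml sum_neq0 sum_mchar // mchar0 // subrr mul0r.
Qed.

Lemma norm_kfun : \sum_(m | m != 0) kfun m * (kfun m)^* = q ^+ 3 - 3%:R * q ^+ 2.
Proof.
(* [S t] is the sum of [psi (t * y)] over nonzero [y]. Writing the variables of the conjugate as
   [y a] and [z b] separates the phase into three independent ones, with coefficients [1 - a],
   [1 - b] and [1 - 1 / (a b)]. *)
pose S (t : F) : algC := q * (t == 0)%:R - 1.
have conjK m : (kfun m)^* = \sum_(y | y != 0) \sum_(z | z != 0)
    eta z / eta y * psi (- (y + z + m / (y * z))).
  rewrite rmorph_sum; apply: eq_bigr => y y0.
  rewrite rmorph_sum; apply: eq_bigr => z z0.
  rewrite !rmorphM fmorphV /= (psi_conj hpsi) !(mchar_conj heta) invrK.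
  by rewrite [_^-1 * _]mulrC.
transitivity (\sum_(a | a != 0) \sum_(b | b != 0)
    eta b / eta a * (S (1 - a) * S (1 - b) * S (1 - (a * b)^-1))).
  transitivity (\sum_(m | m != 0) \sum_(y | y != 0) \sum_(z | z != 0)
     \sum_(a | a != 0) \sum_(b | b != 0) eta b / eta a *
       (psi ((1 - a) * y) * psi ((1 - b) * z)
         * psi ((1 - (a * b)^-1) * ((y * z)^-1 * m)))).
    apply: eq_bigr => m m0; rewrite {1}/kfun mulr_suml.
    apply: eq_bigr => y y0; rewrite mulr_suml; apply: eq_bigr => z z0.
    rewrite conjK mulr_sumr (reindex_scale_neq0 _ y0); apply: eq_bigr => a a0.
    rewrite mulr_sumr (reindex_scale_neq0 _ z0); apply: eq_bigr => b b0.
    have -> : psi ((1 - a) * y) * psi ((1 - b) * z)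
         * psi ((1 - (a * b)^-1) * ((y * z)^-1 * m)) =
       psi (y + z + m / (y * z)) * psi (- (y * a + z * b + m / (y * a * (z * b)))).
      by rewrite -!(psiD hpsi); congr (psi _); field; rewrite y0 z0 a0 b0.
    by rewrite !(mcharM heta); field; rewrite !mchar_neq0 // y0 z0 a0.
  transitivity (\sum_(y | y != 0) \sum_(z | z != 0)
     \sum_(a | a != 0) \sum_(b | b != 0) eta b / eta a *
       (psi ((1 - a) * y) * psi ((1 - b) * z) * S (1 - (a * b)^-1))).
    rewrite exchange_big; apply: eq_bigr => y y0 /=.
    rewrite exchange_big; apply: eq_bigr => z z0 /=.
    rewrite exchange_big; apply: eq_bigr => a a0 /=.
    rewrite exchange_big; apply: eq_bigr => b b0 /=.
    rewrite -!mulr_sumr -(reindex_scale_neq0 (fun m => psi (_ * m))).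
      by rewrite sum_psi_scale_neq0.
    by rewrite invr_eq0 mulf_neq0.
  rewrite exchange_big /=; under eq_bigr do rewrite exchange_big /=.
  rewrite exchange_big; apply: eq_bigr => a a0 /=.
  under eq_bigr do rewrite exchange_big /=.
  rewrite exchange_big; apply: eq_bigr => b b0 /=.
  under eq_bigr do rewrite -mulr_sumr -mulr_suml -mulr_suml sum_psi_scale_neq0 //.
  by rewrite -mulr_sumr -mulr_suml -mulr_sumr sum_psi_scale_neq0.
have sum_eta : \sum_(b | b != 0) eta b = 0.
  by rewrite sum_neq0 sum_mchar // mchar0 // subrr.
have eta'_neq := cconj_neq_eps heta eta_neq.
have sum_etaV : \sum_(b | b != 0) (eta b)^-1 = 0.
  rewrite sum_neq0 mchar0 // invr0 subr0 -[RHS](sum_mchar (mchar_cconj heta)) //.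
  by apply: eq_bigr => b _; rewrite cconjE.
have e1 : eta 1 = 1 by rewrite mchar1.
(* In the sum over [b], the constant term of the product of the two factors [S] vanishes and the
   other three pick [b = 1] or [b = a^-1]. *)
transitivity (\sum_(a | a != 0) (eta a)^-1 * S (1 - a) *
   (q ^+ 2 * (a == 1)%:R - q - q / eta a)).
  apply: eq_bigr => a a0.
  transitivity ((eta a)^-1 * S (1 - a) * \sum_(b | b != 0)
    (eta b * (q * (b == 1)%:R) * (q * (b == a^-1)%:R) - eta b * (q * (b == 1)%:R)
      - eta b * (q * (b == a^-1)%:R) + eta b)).
    rewrite mulr_sumr; apply: eq_bigr => b b0.
    have -> : S (1 - (a * b)^-1) = q * (b == a^-1)%:R - 1.
      rewrite /S; congr (_ * (nat_of_bool _)%:R - 1).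
      rewrite subr_eq0 eq_sym invr_eq1 -(inj_eq (mulfI a0) b) divff //.
    by rewrite {2}/S subr_eq0 eq_sym; ring.
  congr (_ * _); rewrite big_split /= sum_eta addr0 !sumrB.
  have pickb c (f : F -> algC) : c != 0 ->
      \sum_(b | b != 0) f b * (q * (b == c)%:R) = f c * q.
    move=> c0; rewrite (bigD1 c) //= eqxx mulr1 big1 ?addr0 // => b.
    by case/andP=> _ /negPf ->; rewrite !mulr0.
  rewrite !pickb ?invr_eq0 ?oner_eq0 // e1 mcharV // -[a^-1 == 1]invr_eq1 invrK.
  rewrite [q / _]mulrC mul1r; congr (_ - _ - _).
  have [->|_] := eqVneq a 1; last by rewrite !mulr0 mul0r.
  by rewrite e1 invr1 !mulr1 mul1r.
transitivity (\sum_(a | a != 0) (eta a)^-1 * (q * (a == 1)%:R) *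
   (q ^+ 2 * (a == 1)%:R - q - q / eta a) -
   \sum_(a | a != 0) (eta a)^-1 * (q ^+ 2 * (a == 1)%:R - q - q / eta a)).
  rewrite -sumrB; apply: eq_bigr => a a0; rewrite /S subr_eq0 eq_sym; ring.
rewrite (bigD1 1) ?oner_neq0 //= eqxx e1 invr1 !mulr1 mul1r big1 => [|a]; last first.
  by case/andP=> _ /negPf ->; rewrite !mulr0 mul0r.
have -> : \sum_(a | a != 0) (eta a)^-1 * (q ^+ 2 * (a == 1)%:R - q - q / eta a)
   = \sum_(a | a != 0) ((eta a)^-1 * (q ^+ 2 * (a == 1)%:R)
        - q * (eta a)^-1 - q * eta a).
  apply: eq_bigr => a a0; rewrite !mulrBr.
  have -> : (eta a)^-1 * (q / eta a) = q * eta a.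
    by rewrite -[LHS]mulr1 -(eta_cube a0); field; rewrite mchar_neq0.
  by rewrite [_ * q]mulrC.
rewrite !sumrB -!mulr_sumr sum_eta sum_etaV !mulr0 !subr0.
rewrite (bigD1 1) ?oner_neq0 //= eqxx e1 invr1 big1 => [|a]; last first.
  by case/andP=> _ /negPf ->; rewrite !mulr0.
by rewrite mulr1; ring.
Qed.

(* The square norm of [kfun - q kfun0] expands into the three sums above, whose
   contributions cancel. *)
Lemma kfunE m : m != 0 -> kfun m = q * kfun0 m.
Proof.
move=> m0; apply/eqP; rewrite -subr_eq0 -normr_eq0 -sqrf_eq0; apply/eqP.
have : \sum_(m | m != 0) `|kfun m - q * kfun0 m| ^+ 2 = 0.
  transitivity (\sum_(m | m != 0) kfun m * (kfun m)^*
     - q * (\sum_(m | m != 0) kfun m * (kfun0 m)^*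
            + (\sum_(m | m != 0) kfun m * (kfun0 m)^* )^*)
     + q ^+ 2 * \sum_(m | m != 0) kfun0 m * (kfun0 m)^*).
    rewrite rmorph_sum -big_split !mulr_sumr -sumrB -big_split /=.
    apply: eq_bigr => n _; rewrite normCK rmorphB !rmorphM /= conjCK conjC_nat.
    by ring.
  rewrite norm_kfun inner_kfun norm_kfun0 rmorphM rmorphB /= !conjC_nat; ring.
move/eqP; rewrite psumr_eq0 => [/allP h|n _]; last exact: exprn_ge0.
by have := h m (mem_index_enum m); rewrite m0 => /eqP.
Qed.

(** The identity [kfunE] tested against an arbitrary [g]. For a character it is the Hasse-Davenport
    relation; other [g] serve to merge three variables inside the phase of a hypergeometric sum. *)
Lemma triple_sum (g : F -> algC) :
  \sum_(t | t != 0) \sum_(y | y != 0) \sum_(z | z != 0)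
    eta y / eta z * psi (t + y + z) * g (t * y * z) =
  q * \sum_(n | n != 0) psi (3%:R * n) * g (n ^+ 3).
Proof.
under [in RHS]eq_bigr do rewrite mulrC.
rewrite -sum_kfun0 mulr_sumr.
transitivity (\sum_(m | m != 0) g m * kfun m); last first.
  by apply: eq_bigr => m m0; rewrite kfunE // mulrCA.
rewrite exchange_big /=; under eq_bigr do rewrite exchange_big /=.
under [in RHS]eq_bigr do rewrite mulr_sumr.
rewrite [in RHS]exchange_big /=; apply: eq_bigr => y y0.
under [in RHS]eq_bigr do rewrite mulr_sumr.
rewrite [in RHS]exchange_big /=; apply: eq_bigr => z z0.
have yz0 : (y * z)^-1 != 0 by rewrite invr_eq0 mulf_neq0.
rewrite (reindex_scale_neq0 _ yz0); apply: eq_bigr => m m0.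
have -> : (y * z)^-1 * m * y * z = m by field; rewrite y0 z0.
have -> : (y * z)^-1 * m + y + z = y + z + m / (y * z) by field; rewrite y0 z0.
by rewrite mulrC.
Qed.

End CubicGaussSum.
End CubicCharacter.

(** * The ternary quadratic form *)

Section TernaryFormSum.
Variables (F : finFieldType) (psi : F -> algC).
Hypothesis hpsi : add_char psi.
Hypothesis odd_card : odd #|F|.
Hypothesis two_neq0 : (2%:R : F) != 0.
Implicit Types (x y z r s t a b c V W : F).

Local Notation q := (#|F|%:R : algC).
Local Notation phi := (@qchar F).

Let hphi : mchar phi := mchar_qchar odd_card.

Lemma reindex_inv_neq0 (f : F -> algC) :
  \sum_(y | y != 0) f y = \sum_(y | y != 0) f y^-1.
Proof.
by rewrite (reindex_inj invr_inj); apply: eq_bigl => y; rewrite invr_eq0.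
Qed.

Lemma reindex_opp_neq0 (f : F -> algC) :
  \sum_(y | y != 0) f y = \sum_(y | y != 0) f (- y).
Proof.
by rewrite (reindex_inj oppr_inj); apply: eq_bigl => y; rewrite oppr_eq0.
Qed.

Lemma sum_neq0_mchar (X f : F -> algC) : mchar X ->
  \sum_(y | y != 0) X y * f y = \sum_y X y * f y.
Proof. by move=> hX; rewrite sum_neq0 mchar0 // mul0r subr0. Qed.

Lemma sum_neq0_const (a : algC) : \sum_(x : F | x != 0) a = (q - 1) * a.
Proof. by rewrite sum_neq0 sum_const mulrBl mul1r. Qed.

Lemma gsum_qchar_twist w :
  \sum_(n | n != 0) phi n * psi (n * w) = phi w * gsum psi phi.
Proof.
rewrite (sum_neq0_mchar (fun n => psi (n * w))) // gsum_twist //.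
  by rewrite qcharV.
exact: qchar_neq_eps.
Qed.

Lemma sum_torus (f : F -> F -> F -> algC) :
  \sum_(a | a != 0) \sum_(b | b != 0) \sum_(c | c != 0) f a b c =
  \sum_a \sum_b \sum_c f a b c
  - \sum_b \sum_c f 0 b c - \sum_a \sum_c f a 0 c - \sum_a \sum_b f a b 0
  + \sum_c f 0 0 c + \sum_b f 0 b 0 + \sum_a f a 0 0 - f 0 0 0.
Proof.
have two a : \sum_(b | b != 0) \sum_(c | c != 0) f a b c =
    \sum_b \sum_c f a b c - \sum_b f a b 0 - \sum_c f a 0 c + f a 0 0.
  rewrite sum_neq0; under eq_bigr do rewrite sum_neq0.
  rewrite sumrB !sum_neq0; ring.
under eq_bigr do rewrite two.
rewrite sum_neq0 big_split !sumrB /=; ring.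
Qed.

Let four_neq0 : (4%:R : F) != 0 := natr4_neq0 two_neq0.

Section TwoCharacters.
Variables P Q : F -> algC.
Hypotheses (hP : mchar P) (hQ : mchar Q).

(** Both hypergeometric sides reduce to this sum times explicit Gauss sums, apart from the delta
    terms. *)
Definition dsum x : algC := \sum_(r | r != 0) \sum_(s | s != 0)
  P r * Q s * phi (1 - x + r + s + x / (4%:R * r * s)).

(** Scaling [r] and [s] by [n] makes the phase [n] times a function of [r] and [s]; the condition on
    [C], [P], [Q] leaves [phi n], and the sum over [n] is a twisted quadratic Gauss sum. *)
Lemma dsum_gsum (C : F -> algC) x : mchar C ->
  (forall n, n != 0 -> C n * P n * Q n = phi n) ->
  \sum_(n | n != 0) \sum_(r | r != 0) \sum_(s | s != 0)
    C n * P r * Q s * psi (n - n * x + r + s + x * n ^+ 3 / (4%:R * r * s))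
  = gsum psi phi * dsum x.
Proof.
move=> hC CPQ.
transitivity (\sum_(n | n != 0) \sum_(r | r != 0) \sum_(s | s != 0)
   P r * Q s * (phi n * psi (n * (1 - x + r + s + x / (4%:R * r * s))))).
  apply: eq_bigr => n n0; rewrite (reindex_scale_neq0 _ n0).
  apply: eq_bigr => r r0; rewrite (reindex_scale_neq0 _ n0).
  apply: eq_bigr => s s0; rewrite -CPQ // (mcharM hP) (mcharM hQ).
  have -> : n * (1 - x + r + s + x / (4%:R * r * s)) =
      n - n * x + n * r + n * s + x * n ^+ 3 / (4%:R * (n * r) * (n * s)).
    by field; rewrite n0 r0 s0 four_neq0.
  by ring.
rewrite exchange_big /dsum mulr_sumr; apply: eq_bigr => r r0 /=.
rewrite exchange_big mulr_sumr; apply: eq_bigr => s s0 /=.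
by rewrite -mulr_sumr gsum_qchar_twist; ring.
Qed.

Hypothesis nP : cmul phi P <> eps.
Hypothesis nQ : cmul phi Q <> eps.
Hypothesis nPQ : cmul phi (cmul P (cconj Q)) <> eps.

Let sumP : \sum_(V | V != 0) phi V * P V = 0.
Proof. by rewrite sum_neq0_mchar // -[RHS](sum_mchar _ nP) //; apply: mchar_cmul. Qed.

Let sumQ : \sum_(W | W != 0) phi W * Q W = 0.
Proof. by rewrite sum_neq0_mchar // -[RHS](sum_mchar _ nQ) //; apply: mchar_cmul. Qed.

Let sumPQ : \sum_(V | V != 0) phi V * (P V / Q V) = 0.
Proof.
have hQ' := mchar_cconj hQ.
rewrite sum_neq0_mchar // -[RHS](sum_mchar _ nPQ); last by do ?apply: mchar_cmul.
by apply: eq_bigr => V _; rewrite /cmul cconjE.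
Qed.

Definition tform U V W a b c :=
  U * a ^+ 2 + V * b ^+ 2 + W * c ^+ 2 + a * b + b * c + c * a.

Let qchar4 : phi 4%:R = 1.
Proof. by rewrite -(qchar_sqr two_neq0) -natrX. Qed.

Let sumsq d : \sum_c phi (d * c ^+ 2) = (q - 1) * phi d.
Proof.
under eq_bigr do rewrite mcharM //.
rewrite -mulr_sumr mulrC; congr (_ * _).
under eq_bigr do rewrite -[_ ^+ 2]addr0.
by rewrite sum_qchar_sqr_add // eqxx mulr1.
Qed.

(* Each boundary contribution contains one of the three vanishing sums above. *)
Lemma sum_torus_form x : x != 0 ->
  \sum_(V | V != 0) \sum_(W | W != 0) P V * Q W *
    \sum_(a | a != 0) \sum_(b | b != 0) \sum_(c | c != 0)
      phi (tform (- x / (4%:R * V * W)) V W a b c) =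
  \sum_(V | V != 0) \sum_(W | W != 0) P V * Q W *
    \sum_a \sum_b \sum_c phi (tform (- x / (4%:R * V * W)) V W a b c).
Proof.
move=> x0.
pose k := phi (- x).
transitivity (\sum_(V | V != 0) \sum_(W | W != 0) (P V * Q W *
    (\sum_a \sum_b \sum_c phi (tform (- x / (4%:R * V * W)) V W a b c))
  - q * (q - 1) * (phi V * P V * ((4%:R * V * W == 1)%:R * Q W))
  - q * (q - 1) * k * ((V == - x)%:R * (phi V * P V) * (phi W * Q W))
  - q * (q - 1) * k * ((W == - x)%:R * (phi W * Q W) * (phi V * P V))
  + (q - 1) * (P V * (phi W * Q W))
  + (q - 1) * (Q W * (phi V * P V))
  + (q - 1) * k * (phi W * Q W * (phi V * P V)))).
  apply: eq_bigr => V V0; apply: eq_bigr => W W0.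
  set U := - x / _.
  have U0 : U != 0 by rewrite !mulf_neq0 ?invr_eq0 ?mulf_neq0 ?oppr_eq0.
  have phiU : phi U = k * phi V * phi W.
    rewrite /U (mcharM hphi) (mcharV hphi) qcharV // !(mcharM hphi) qchar4 mul1r.
    by rewrite mulrA.
  (* Since [4 U V W = - x], the faces [b = 0] and [c = 0] are degenerate exactly for [V = - x] and
     for [W = - x]. *)
  have UW : (4%:R * U * W == 1) = (V == - x).
    rewrite -[RHS](inj_eq (mulIf (invr_neq0 V0))) divff // eq_sym.
    by congr (_ == _); rewrite /U; field; rewrite V0 W0.
  have UV : (4%:R * U * V == 1) = (W == - x).
    rewrite -[RHS](inj_eq (mulIf (invr_neq0 W0))) divff // eq_sym.
    by congr (_ == _); rewrite /U; field; rewrite V0 W0.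
  rewrite (sum_torus (fun a b c => phi (tform U V W a b c))).
  have -> : \sum_b \sum_c phi (tform U V W 0 b c) =
      (4%:R * V * W == 1)%:R * (q * (q - 1) * phi V).
    rewrite -sum_qchar_binary //; apply: eq_bigr => b _; apply: eq_bigr => c _.
    by congr (phi _); rewrite /tform; ring.
  have -> : \sum_a \sum_c phi (tform U V W a 0 c) =
      (4%:R * U * W == 1)%:R * (q * (q - 1) * phi U).
    rewrite -sum_qchar_binary //; apply: eq_bigr => a _; apply: eq_bigr => c _.
    by congr (phi _); rewrite /tform; ring.
  have -> : \sum_a \sum_b phi (tform U V W a b 0) =
      (4%:R * U * V == 1)%:R * (q * (q - 1) * phi U).
    rewrite -sum_qchar_binary //; apply: eq_bigr => a _; apply: eq_bigr => b _.
    by congr (phi _); rewrite /tform; ring.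
  have -> : \sum_c phi (tform U V W 0 0 c) = (q - 1) * phi W.
    by rewrite -sumsq; apply: eq_bigr => c _; congr (phi _); rewrite /tform; ring.
  have -> : \sum_b phi (tform U V W 0 b 0) = (q - 1) * phi V.
    by rewrite -sumsq; apply: eq_bigr => b _; congr (phi _); rewrite /tform; ring.
  have -> : \sum_a phi (tform U V W a 0 0) = (q - 1) * phi U.
    by rewrite -sumsq; apply: eq_bigr => a _; congr (phi _); rewrite /tform; ring.
  have -> : phi (tform U V W 0 0 0) = 0.
    by rewrite -[RHS](mchar0 hphi); congr (phi _); rewrite /tform; ring.
  by rewrite UW UV phiU; ring.
pose Z (f : F -> F -> algC) := \sum_(V | V != 0) \sum_(W | W != 0) f V W.
(* On the face [a = 0] the condition [4 V W = 1] ties [W] to [V], and what remains is the sum of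
   [phi P / Q]. *)
have Z1 : Z (fun V W => phi V * P V * ((4%:R * V * W == 1)%:R * Q W)) = 0.
  transitivity (\sum_(V | V != 0) (Q 4%:R)^-1 * (phi V * (P V / Q V))).
    apply: eq_bigr => V V0; rewrite (bigD1 (4%:R * V)^-1) /=; last first.
      by rewrite invr_eq0 mulf_neq0.
    rewrite divff ?mulf_neq0 // eqxx mul1r big1 => [|W /andP[_ ne]].
      by rewrite addr0 (mcharV hQ) (mcharM hQ) invfM; ring.
    case: eqP => [e|_]; last by rewrite mul0r mulr0.
    case/eqP: ne; apply: (mulfI (mulf_neq0 four_neq0 V0)).
    by rewrite e divff // mulf_neq0.
  by rewrite -mulr_sumr sumPQ mulr0.
have ZQ f : Z (fun V W => f V * (phi W * Q W)) = 0.
  by rewrite /Z big1 // => V _; rewrite -mulr_sumr sumQ mulr0.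
have ZP f : Z (fun V W => f W * (phi V * P V)) = 0.
  by rewrite /Z exchange_big big1 //= => W _; rewrite -mulr_sumr sumP mulr0.
transitivity (Z (fun V W => P V * Q W *
    (\sum_a \sum_b \sum_c phi (tform (- x / (4%:R * V * W)) V W a b c)))
  - q * (q - 1) * Z (fun V W => phi V * P V * ((4%:R * V * W == 1)%:R * Q W))
  - q * (q - 1) * k * Z (fun V W => (V == - x)%:R * (phi V * P V) * (phi W * Q W))
  - q * (q - 1) * k * Z (fun V W => (W == - x)%:R * (phi W * Q W) * (phi V * P V))
  + (q - 1) * Z (fun V W => P V * (phi W * Q W))
  + (q - 1) * Z (fun V W => Q W * (phi V * P V))
  + (q - 1) * k * Z (fun V W => phi W * Q W * (phi V * P V))).
  rewrite /Z !mulr_sumr -!sumrB -!big_split; apply: eq_bigr => V _ /=.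
  by rewrite !mulr_sumr -!sumrB -!big_split.
rewrite Z1 ZQ ZP (ZQ P) (ZP Q) (ZP (fun W => phi W * Q W)).
by rewrite !mulr0 !subr0 !addr0.
Qed.

(* Averaging over the scaling [(a, b, c) -> l (a, b, c)] turns the additive
   character into [phi]. *)
Lemma tform_gsum U V W :
  (q - 1) * (\sum_(t | t != 0) \sum_(y | y != 0) \sum_(z | z != 0)
    phi (t * y * z) * psi (t + y + z + U * y * z / t + V * t * z / y + W * t * y / z))
  = gsum psi phi * (\sum_(a | a != 0) \sum_(b | b != 0) \sum_(c | c != 0)
      phi (tform U V W a b c)).
Proof.
transitivity (\sum_(l | l != 0) \sum_(a | a != 0) \sum_(b | b != 0)
   \sum_(c | c != 0) phi (l * a * b * c)^-1 *
     psi ((l * a * b * c)^-1 * tform U V W a b c)).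
  rewrite -sum_neq0_const; apply: eq_bigr => l l0.
  (* With [t = 1 / (l a)], [y = 1 / (l b)], [z = 1 / (l c)] the phase becomes the form divided by
     [l a b c], and [phi] loses the square [l^2]. *)
  rewrite reindex_inv_neq0 (reindex_scale_neq0 _ l0); apply: eq_bigr => a a0.
  rewrite reindex_inv_neq0 (reindex_scale_neq0 _ l0); apply: eq_bigr => b b0.
  rewrite reindex_inv_neq0 (reindex_scale_neq0 _ l0); apply: eq_bigr => c c0.
  congr (_ * psi _).
    rewrite -!invfM !(mcharV hphi); congr (_^-1).
    have -> : l * a * (l * b) * (l * c) = l ^+ 2 * (l * a * b * c) by ring.
    by rewrite (mcharM hphi) qchar_sqr // mul1r.
  by rewrite /tform; field; rewrite l0 a0 b0 c0 oner_eq0.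
rewrite exchange_big mulr_sumr; apply: eq_bigr => a a0 /=.
rewrite exchange_big mulr_sumr; apply: eq_bigr => b b0 /=.
rewrite exchange_big mulr_sumr; apply: eq_bigr => c c0 /=.
have abc0 : (a * b * c)^-1 != 0 by rewrite invr_eq0 !mulf_neq0.
rewrite [RHS]mulrC -gsum_qchar_twist reindex_inv_neq0 [RHS](reindex_scale_neq0 _ abc0).
by apply: eq_bigr => l _; rewrite !invfM invrK; congr (phi _ * psi (_ * _)); ring.
Qed.

(** Substituting [s = (t z / y) V] and [r = (t y / z) W] removes the quotients from [P] and [Q] and
    creates the phase of [tform_gsum] with [U = - x / (4 V W)]; [sum_torus_form] and
    [sum_qchar_ternary] then evaluate the inner sums. *)
Lemma sum_two_characters x : x != 0 ->
  \sum_(r | r != 0) \sum_(s | s != 0) \sum_(t | t != 0) \sum_(y | y != 0)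
    \sum_(z | z != 0) phi (t * y * z) * P (y / (t * z)) * Q (z / (t * y))
      * Q r * P s * psi (t + y + z + r + s - x / 4%:R * (t * y * z) / (r * s))
  = gsum psi phi * (q * (phi (-1) * P (-1) * Q (-1)) * dsum x +
      delta (x + 2%:R^-1) * q ^+ 2 * (phi 2%:R / (P 2%:R * Q 2%:R))).
Proof.
move=> x0.
have q10 : q - 1 != 0.
  have := card_pred_gt0 F; rewrite lt0n -(pnatr_eq0 algC) -subn1 natrB //.
  exact: card_field_gt0.
(* Both sides are multiplied by [q - 1], the factor that the averaging in [tform_gsum] produces. *)
apply: (mulfI q10).
transitivity (\sum_(V | V != 0) \sum_(W | W != 0) P V * Q W * ((q - 1) *
   \sum_(t | t != 0) \sum_(y | y != 0) \sum_(z | z != 0)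
    phi (t * y * z) * psi (t + y + z + (- x / (4%:R * V * W)) * y * z / t
      + V * t * z / y + W * t * y / z))).
  transitivity ((q - 1) * \sum_(t | t != 0) \sum_(y | y != 0) \sum_(z | z != 0)
    \sum_(V | V != 0) \sum_(W | W != 0) P V * Q W * (phi (t * y * z) *
      psi (t + y + z + (- x / (4%:R * V * W)) * y * z / t
      + V * t * z / y + W * t * y / z))); last first.
    rewrite mulr_sumr.
    under [RHS]eq_bigr do under eq_bigr do rewrite mulrCA.
    under [RHS]eq_bigr do rewrite -mulr_sumr.
    rewrite -mulr_sumr -mulr_sumr; congr (_ * _).
    under [RHS]eq_bigr do under eq_bigr do rewrite mulr_sumr.
    under [RHS]eq_bigr do rewrite exchange_big /=.
    rewrite [RHS]exchange_big; apply: eq_bigr => t t0 /=.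
    under [RHS]eq_bigr do under eq_bigr do rewrite mulr_sumr.
    under [RHS]eq_bigr do rewrite exchange_big /=.
    rewrite [RHS]exchange_big; apply: eq_bigr => y y0 /=.
    under [RHS]eq_bigr do under eq_bigr do rewrite mulr_sumr.
    under [RHS]eq_bigr do rewrite exchange_big /=.
    by rewrite [RHS]exchange_big.
  congr (_ * _).
  under eq_bigr do rewrite exchange_big /=.
  rewrite exchange_big; apply: eq_bigr => t t0 /=.
  under eq_bigr do rewrite exchange_big /=.
  rewrite exchange_big; apply: eq_bigr => y y0 /=.
  under eq_bigr do rewrite exchange_big /=.
  rewrite exchange_big; apply: eq_bigr => z z0 /=.
  have c1 : t * z / y != 0 by rewrite !mulf_neq0 ?invr_eq0.
  have c2 : t * y / z != 0 by rewrite !mulf_neq0 ?invr_eq0.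
  rewrite exchange_big (reindex_scale_neq0 _ c1); apply: eq_bigr => V V0 /=.
  rewrite (reindex_scale_neq0 _ c2); apply: eq_bigr => W W0.
  have -> : t + y + z + t * y / z * W + t * z / y * V
      - x / 4%:R * (t * y * z) / (t * y / z * W * (t * z / y * V)) =
    t + y + z + - x / (4%:R * V * W) * y * z / t + V * t * z / y + W * t * y / z.
    by field; rewrite t0 y0 z0 V0 W0 four_neq0.
  rewrite (mcharM hP _ V) (mcharM hQ _ W) !(mcharM hP) !(mcharM hQ).
  rewrite !(mcharV hP) !(mcharV hQ) !(mcharM hP) !(mcharM hQ).
  by field; rewrite !mchar_neq0 // t0 y0 z0.
transitivity (gsum psi phi * \sum_(V | V != 0) \sum_(W | W != 0) P V * Q W *
    \sum_a \sum_b \sum_c phi (tform (- x / (4%:R * V * W)) V W a b c)).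
  rewrite -sum_torus_form // mulr_sumr; apply: eq_bigr => V V0.
  by rewrite mulr_sumr; apply: eq_bigr => W W0; rewrite tform_gsum mulrCA.
rewrite mulrCA; congr (_ * _).
transitivity (\sum_(V | V != 0) \sum_(W | W != 0)
   (q * (q - 1) * (P V * Q W * phi (- (1 - x - V - W + x / (4%:R * V * W)))) +
   (q ^+ 2 * (q - 1) * phi 2%:R * delta (x + 2%:R^-1)) *
     ((V == 2%:R^-1)%:R * P V * ((W == 2%:R^-1)%:R * Q W)))).
  apply: eq_bigr => V V0; apply: eq_bigr => W W0; rewrite /tform.
  set U := - x / _.
  have U0 : U != 0 by rewrite !mulf_neq0 ?invr_eq0 ?mulf_neq0 ?oppr_eq0.
  rewrite sum_qchar_ternary //.
  have -> : 1 - U - V - W + 4%:R * U * V * W =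
     1 - x - V - W + x / (4%:R * V * W).
    by rewrite /U; field; rewrite V0 W0 four_neq0.
  have -> : [&& U == 2%:R^-1, V == 2%:R^-1 & W == 2%:R^-1]%:R =
     delta (x + 2%:R^-1) * ((V == 2%:R^-1)%:R * (W == 2%:R^-1)%:R) :> algC.
    rewrite -natrM mulnb; have [VE|_] := eqVneq V; last by rewrite andbF mulr0.
    have [WE|_] /= := eqVneq W; last by rewrite andbF mulr0.
    rewrite andbT mulr1 /delta addr_eq0.
    (* For [V = W = 1/2] one has [U = - x], so the rank one case occurs exactly at [x = - 1/2]. *)
    have -> : U = - x by rewrite /U VE WE; field; rewrite four_neq0 two_neq0.
    by rewrite eqr_oppLR; case: eqP.
  by ring.
under eq_bigr do rewrite big_split -!mulr_sumr /=.
rewrite big_split -!mulr_sumr /= [RHS]mulrDr; congr (_ + _).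
  rewrite [X in _ * X = _](_ : _ = phi (-1) * P (-1) * Q (-1) * dsum x); first by ring.
  rewrite reindex_opp_neq0 /dsum mulr_sumr; apply: eq_bigr => V V0.
  rewrite reindex_opp_neq0 mulr_sumr; apply: eq_bigr => W W0.
  rewrite -[- V]mulN1r -[- W]mulN1r (mcharM hP) (mcharM hQ).
  have -> : - (1 - x - -1 * V - -1 * W + x / (4%:R * (-1 * V) * (-1 * W))) =
     -1 * (1 - x + V + W + x / (4%:R * V * W)).
    by field; rewrite V0 W0 four_neq0 oppr_eq0 oner_eq0.
  by rewrite (mcharM hphi); ring.
have pick2 X : mchar X -> \sum_(V : F | V != 0) (V == 2%:R^-1)%:R * X V = (X 2%:R)^-1.
  move=> hX; rewrite (bigD1 2%:R^-1) ?invr_eq0 //= eqxx mul1r mcharV // big1 ?addr0 //.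
  by move=> V /andP[_ /negPf ->]; rewrite mul0r.
under eq_bigr do rewrite pick2 //.
by rewrite -mulr_suml pick2 // invfM; ring.
Qed.

End TwoCharacters.
End TernaryFormSum.

(** * Cubic characters *)

Section CubicRelations.
Variables (F : finFieldType) (eta : F -> algC).
Hypothesis three_dvd : (3 %| #|F|.-1)%N.
Hypothesis three_neq0 : (3%:R : F) != 0.
Hypotheses (heta : mchar eta) (eta3 : cexp eta 3 = eps) (eta_neq : eta <> eps).

Lemma eq_mchar_prim_root (u : F) (X Y : F -> algC) :
  (#|F|.-1).-primitive_root u -> mchar X -> mchar Y -> X u = Y u -> X = Y.
Proof.
move=> hu hX hY e; apply: eq_mchar => // x /expf_card_pred /(prim_rootP hu)[i ->].
by rewrite !mcharX // e.
Qed.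

Lemma eta_prim_root (u : F) : (#|F|.-1).-primitive_root u ->
  eta u != 1 /\ eta u ^+ 2 + eta u + 1 = 0.
Proof.
move=> hu; have u0 := prim_root_neq0 hu.
have n1 : eta u != 1.
  apply/eqP => e; apply: eta_neq; apply: (eq_mchar_prim_root hu) => //.
    exact: mchar_eps.
  by rewrite e /eps (negPf u0).
split=> //; apply: (mulfI (x := eta u - 1)); first by rewrite subr_eq0.
rewrite mulr0; transitivity (eta u ^+ 3 - 1); first by ring.
by rewrite (eta_cube eta3) // subrr.
Qed.

(** For [w = u^i] with [u] a generator, both sides depend on [i] modulo [3] only: three roots and
    [eta w = 1] if [3] divides [i], otherwise no root and [eta w] a primitive cube root of unity. *)
Lemma card_cube_roots (w : F) : w != 0 ->
  \sum_(n | n != 0) ((n ^+ 3 == w)%:R : algC) = 1 + eta w + eta w ^+ 2.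
Proof.
move=> w0; have [u hu] := finField_prim_root F.
have [e1 e2] := eta_prim_root hu.
have [om omE] := exists_cube_root1 three_dvd.
have [m0 m1 mN1 m21 m2] := om_neq three_neq0 omE.
have m20 := om2_neq0 three_neq0 omE.
have [i wi] := prim_rootP hu (expf_card_pred w0).
case: (boolP (3 %| i)%N) => di.
  pose n0 := u ^+ (i %/ 3).
  have wE : w = n0 ^+ 3 by rewrite wi /n0 -exprM divnK.
  have n00 : n0 != 0 by rewrite expf_neq0 // prim_root_neq0.
  have -> : eta w = 1 by rewrite wE mcharX // (eta_cube eta3).
  have omn a b : a != b -> a * n0 != b * n0 by rewrite (inj_eq (mulIf n00)).
  have n1 : om * n0 != n0 by rewrite -[X in _ != X]mul1r omn.
  have n2 : (-1 - om) * n0 != n0 by rewrite -[X in _ != X]mul1r omn.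
  rewrite (bigD1 n0) //= (bigD1 (om * n0)) /=; last by rewrite n1 mulf_neq0.
  rewrite (bigD1 ((-1 - om) * n0)) /=; last by rewrite n2 mulf_neq0 ?omn.
  rewrite wE !(cubeE omE) !eqxx !orbT big1 ?addr0 ?expr1n ?addrA // => x.
  case/andP=> /andP[/andP[_ a] b] c.
  by rewrite (cubeE omE) (negPf a) (negPf b) (negPf c).
rewrite big1 => [|n n0]; last first.
  case: eqP => // nw; case/negP: di.
  have [j nj] := prim_rootP hu (expf_card_pred n0).
  move/eqP: nw; rewrite nj wi -exprM (eq_prim_root_expr hu) => /eqP e.
  by rewrite /dvdn -(modn_dvdm i three_dvd) -e modn_dvdm // modnMl.
have e3 := eta_cube eta3 (prim_root_neq0 hu).
rewrite wi mcharX // -(expr_mod i e3) -exprM -(expr_mod (_ * 2) e3).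
have: (i %% 3 < 3)%N by rewrite ltn_mod.
move: di; rewrite /dvdn; case: (i %% 3)%N => [|[|[|k]]] //= _ _.
  by rewrite -e2 expr1; ring.
by rewrite -e2 (_ : (2 * 2 %% 3)%N = 1%N) // expr1; ring.
Qed.

Lemma sum_cubes (f : F -> algC) :
  \sum_(n | n != 0) f (n ^+ 3) =
  \sum_(w | w != 0) f w * (1 + eta w + eta w ^+ 2).
Proof.
transitivity (\sum_(w : F | w != 0) \sum_(n : F | n != 0) f w * (n ^+ 3 == w)%:R).
  rewrite exchange_big; apply: eq_bigr => n n0 /=.
  rewrite (bigD1 (n ^+ 3)) ?expf_neq0 //= eqxx mulr1 big1 ?addr0 // => w.
  by case/andP=> _ ne; rewrite eq_sym (negPf ne) mulr0.
by apply: eq_bigr => w w0; rewrite -mulr_sumr card_cube_roots.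
Qed.

Lemma eta_conj (x : F) : x != 0 -> cconj eta x = eta x ^+ 2.
Proof.
move=> x0; rewrite cconjE // -[LHS]mulr1 -(eta_cube eta3 x0); field.
by rewrite mchar_neq0.
Qed.

(** Any two duplicate-free enumerations of the same characters are permutations of each other, so
    the choice made by [epsilon] does not matter and an explicit list of three characters may be
    used. *)
Lemma char_sum_cubic (A : F -> algC) (G : (F -> algC) -> algC) : mchar A ->
  char_sum (fun chi => cexp chi 3 = cexp (cconj A) 3) G =
  G (cconj A) + G (cconj (cmul A eta)) + G (cconj (cmul A (cconj eta))).
Proof.
move=> hA; have [u hu] := finField_prim_root F.
have [e1 e2] := eta_prim_root hu; have u0 := prim_root_neq0 hu.
have heta' := mchar_cconj heta.
have hA1 := mchar_cconj hA; have hA2 := mchar_cconj (mchar_cmul hA heta).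
have hA3 := mchar_cconj (mchar_cmul hA heta').
have e0 : eta u != 0 by rewrite mchar_neq0.
have a0 : A u != 0 by rewrite mchar_neq0.
have e3 : eta u ^+ 3 = 1 by rewrite (eta_cube eta3).
have u1 : cconj A u = (A u)^-1 by rewrite cconjE.
have u2 : cconj (cmul A eta) u = (A u)^-1 * eta u ^+ 2.
  by rewrite /cconj /cmul rmorphM /= -/(cconj eta u) eta_conj // -/(cconj A u) u1.
have u3 : cconj (cmul A (cconj eta)) u = (A u)^-1 * eta u.
  by rewrite /cconj /cmul rmorphM /= conjCK -/(cconj A u) u1.
pose s := [:: finfun (cconj A); finfun (cconj (cmul A eta));
              finfun (cconj (cmul A (cconj eta)))].
have ffK (X : F -> algC) : finfun X = X :> (F -> algC).
  by apply: functional_extensionality => x; rewrite ffunE.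
have cubic X : mchar X -> (forall x, x != 0 -> X x ^+ 3 = 1) ->
    forall x, cexp (cconj (cmul A X)) 3 x = cexp (cconj A) 3 x.
  move=> hX X3 x; rewrite !cexpE /cconj /cmul rmorphM exprMn -[((X x)^*) ^+ 3]rmorphXn /=.
  have [->|x0] := eqVneq x 0; last by rewrite X3 // rmorph1 mulr1.
  by rewrite (mchar0 hA) rmorph0 expr0n mul0r.
have spec : charset_spec (fun chi => cexp chi 3 = cexp (cconj A) 3) s.
  have A_inj z z' : z != z' -> (A u)^-1 * z != (A u)^-1 * z'.
    by rewrite (inj_eq (mulfI (invr_neq0 a0))).
  have e12 : eta u ^+ 2 != 1.
    apply: contra_neq e1 => e; transitivity (eta u ^+ 2 * eta u); first by rewrite e mul1r.
    by rewrite -exprSr.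
  have e21 : eta u ^+ 2 != eta u.
    by rewrite expr2 -[X in _ != X]mulr1 (inj_eq (mulfI e0)).
  split.
    have neq (X Y : F -> algC) : X u != Y u -> finfun X != finfun Y :> {ffun F -> algC}.
      by apply: contra_neq => /(congr1 (fun f : {ffun F -> algC} => f u)); rewrite !ffunE.
    rewrite /= !inE negb_or !neq //= ?u1 ?u2 ?u3; try exact: A_inj.
      by rewrite -[X in X != _]mulr1 A_inj // eq_sym.
    by rewrite -[X in X != _]mulr1 A_inj // eq_sym.
  move=> f; split.
    rewrite !inE => /or3P[] /eqP ->; (split; first by rewrite (ffK _)).
    - by rewrite (ffK _).
    - rewrite (ffK _); apply: functional_extensionality; apply: cubic => // x.
      exact: (eta_cube eta3).
    - rewrite (ffK _); apply: functional_extensionality; apply: cubic => // x x0.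
      by rewrite eta_conj // -exprM mulnC exprM (eta_cube eta3) // expr1n.
  case=> hf f3; have := congr1 (fun g => g u) f3; rewrite !cexpE u1 => fu.
  have fu3 : (f u * A u) ^+ 3 = 1.
    by rewrite exprMn fu -exprMn mulVf // expr1n.
  (* At a generator [f A] is a cube root of unity, hence [1], [eta u] or [eta u ^+ 2]; its value
     there determines the character. *)
  have : (f u * A u - 1) * (f u * A u - eta u) * (f u * A u - eta u ^+ 2) = 0.
    transitivity ((f u * A u) ^+ 3 - 1
      - (eta u ^+ 2 + eta u + 1) * (f u * A u - 1) * (f u * A u)
      + (eta u ^+ 3 - 1) * (f u * A u - 1)); first by ring.
    by rewrite fu3 e2 e3 !subrr !mul0r subrr addr0.
  have fE X z : mchar X -> X u = (A u)^-1 * z -> f u * A u = z -> f = finfun X.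
    move=> hX Xu fz; apply/ffunP => x; rewrite ffunE.
    apply: (congr1 (fun g : F -> algC => g x)).
    apply: (eq_mchar_prim_root hu) => //.
    by rewrite Xu -fz mulrC mulfK.
  move/eqP; rewrite !mulf_eq0 !subr_eq0 => /orP[/orP[]|] /eqP fz; rewrite !inE.
  - by rewrite (fE (cconj A) 1) ?eqxx // mulr1.
  - by rewrite (fE _ _ hA3 u3 fz) eqxx !orbT.
  - by rewrite (fE _ _ hA2 u2 fz) eqxx !orbT.
rewrite /char_sum; set l := epsilon _ _.
have [ul hl] : charset_spec (fun chi => cexp chi 3 = cexp (cconj A) 3) l.
  by apply: epsilon_spec; exists s.
have [us hs] := spec.
rewrite (perm_big s) /=; last first.
  apply: uniq_perm => // f; apply/idP/idP => [/hl /hs //|/hs /hl //].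
rewrite !big_cons big_nil addr0 addrA.
by congr (G _ + G _ + G _); exact: ffK.
Qed.

End CubicRelations.

(** * The transformation formula *)

Section Hsum.
Variables (F : finFieldType) (psi : F -> algC).

Lemma sum_vanish0 (f : F -> algC) : f 0 = 0 -> \sum_y f y = \sum_(y | y != 0) f y.
Proof. by move=> f0; rewrite sum_neq0 f0 subr0. Qed.

Lemma hsum_neq0 A1 A2 A3 B1 B2 (lam : F) :
  mchar A1 -> mchar A2 -> mchar A3 -> mchar B1 -> mchar B2 ->
  hsum psi A1 A2 A3 B1 B2 lam =
  \sum_(r | r != 0) \sum_(s | s != 0) \sum_(t | t != 0) \sum_(y | y != 0)
    \sum_(z | z != 0) A1 t * A2 y * A3 z * (B1 r)^-1 * (B2 s)^-1 *
      psi (t + y + z + r + s - lam * (t * y * z) / (r * s)).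
Proof.
move=> hA1 hA2 hA3 hB1 hB2; rewrite /hsum sum_vanish0; last first.
  do 4![rewrite big1 // => ? _].
  by rewrite (mchar0 hB1) invr0 mulr0 !mul0r.
apply: eq_bigr => r _; rewrite sum_vanish0; last first.
  do 3![rewrite big1 // => ? _].
  by rewrite (mchar0 hB2) invr0 mulr0 !mul0r.
apply: eq_bigr => s _; rewrite sum_vanish0; last first.
  by do 2![rewrite big1 // => ? _]; rewrite (mchar0 hA1) !mul0r.
apply: eq_bigr => t _; rewrite sum_vanish0; last first.
  by rewrite big1 // => ? _; rewrite (mchar0 hA2) mulr0 !mul0r.
apply: eq_bigr => y _; rewrite sum_vanish0 //.
by rewrite (mchar0 hA3) mulr0 !mul0r.
Qed.

(** Transfers nontriviality from a hypothesis on [Y] to a parameter [X]; in the applications [Y] is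
    a positive or negative power of [X]. *)
Lemma neq_eps_imp (X Y : F -> algC) : mchar Y -> Y <> eps ->
  (forall x, x != 0 -> X x = 1 -> Y x = 1) -> X <> eps.
Proof.
move=> hY nY h Xe; apply: nY; apply: eq_mchar => //; first exact: mchar_eps.
by move=> x x0; rewrite /eps (negPf x0) h // Xe /eps (negPf x0).
Qed.

End Hsum.

Section Transformation.
Variables (F : finFieldType) (psi : F -> algC).
Hypothesis hpsi : add_char psi.
Hypothesis odd_card : odd #|F|.
Hypothesis three_dvd : (3 %| #|F|.-1)%N.
Hypothesis two_neq0 : (2%:R : F) != 0.
Hypothesis three_neq0 : (3%:R : F) != 0.
Variables eta A B : F -> algC.
Hypotheses (heta : mchar eta) (heta3 : cexp eta 3 = eps) (heta1 : eta <> eps).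
Hypotheses (hA : mchar A) (hB : mchar B).
Hypothesis h1 : cexp A 3 <> eps.
Hypothesis h2 : B <> eps.
Hypothesis h3 : cmul (cexp A 3) (cexp (cconj B) 2) <> eps.
Hypothesis h4 : cmul (cexp A 6) (cexp (cconj B) 3) <> eps.
Hypothesis h5 : cmul (cmul qchar (cexp A 3)) (cconj B) <> eps.
Hypothesis h6 : cmul (cmul qchar (cexp A 3)) (cexp (cconj B) 3) <> eps.

Local Notation q := (#|F|%:R : algC).
Local Notation phi := (@qchar F).
Local Notation g := (gsum psi).

Let hphi : mchar phi := mchar_qchar odd_card.
Let hA3 : mchar (cexp A 3) := mchar_cexp 2 hA.
Let hAb : mchar (cconj A) := mchar_cconj hA.
Let hBb : mchar (cconj B) := mchar_cconj hB.
Let hetab : mchar (cconj eta) := mchar_cconj heta.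
(** [P] and [Q] are the conjugates of the two lower parameters, which occur inverted in [hsum]; the
    two sides of the formula share this pair, in opposite order. *)
Let P : F -> algC := cmul phi (cconj B).
Let Q : F -> algC := cmul (cexp (cconj A) 3) B.
Let hP : mchar P := mchar_cmul hphi hBb.
Let hQ : mchar Q := mchar_cmul (mchar_cexp 2 hAb) hB.
Let D1 : F -> algC := cmul (cexp A 3) (cexp (cconj B) 2).
Let D2 : F -> algC := cmul (cexp (cconj A) 3) (cexp B 2).
Let hD1 : mchar D1 := mchar_cmul hA3 (mchar_cexp 1 hBb).
Let hD2 : mchar D2 := mchar_cmul (mchar_cexp 2 hAb) (mchar_cexp 1 hB).
Let hB1 : mchar (cmul phi B) := mchar_cmul hphi hB.
Let hB2 : mchar (cmul (cexp A 3) (cconj B)) := mchar_cmul hA3 hBb.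

Let PE x : P x = phi x / B x. Proof. by rewrite /P cmulE cconjE. Qed.
Let QE x : Q x = B x / A x ^+ 3.
Proof. by rewrite /Q cmulE cexpE cconjE // exprVn mulrC. Qed.

Let conjB1 : cconj (cmul phi B) = P.
Proof.
by apply: functional_extensionality => x; rewrite cconjE // PE cmulE invfM qcharV.
Qed.

Let conjB2 : cconj (cmul (cexp A 3) (cconj B)) = Q.
Proof.
apply: functional_extensionality => x.
by rewrite cconjE // QE cmulE cexpE cconjE // invfM invrK mulrC.
Qed.

Let conjD1 : cconj D1 = D2.
Proof.
apply: functional_extensionality => x.
by rewrite cconjE // /D1 /D2 !cmulE !cexpE !cconjE // invfM !exprVn invrK.
Qed.

(** * Evaluation of the right-hand side *)

Let nD2 : D2 <> eps. Proof. by rewrite -conjD1; apply: cconj_neq_eps. Qed.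

Let nC1 : cmul (cmul (cexp A 3) (cconj B)) (cconj D1) <> eps.
Proof.
apply: (neq_eps_imp hB h2) => x x0.
have a0 : A x != 0 by rewrite mchar_neq0.
have b0 : B x != 0 by rewrite mchar_neq0.
rewrite conjD1 /D2 !cmulE !cexpE !cconjE // => <-.
by field; rewrite a0 b0.
Qed.

Let nC2 : cmul (cmul phi B) (cconj D2) <> eps.
Proof.
apply: (neq_eps_imp _ h5); first by apply: mchar_cmul => //; apply: mchar_cmul.
move=> x x0.
have a0 : A x != 0 by rewrite mchar_neq0.
have b0 : B x != 0 by rewrite mchar_neq0.
rewrite cmulE (cconjE _ hD2) /D2 !cmulE !cexpE !cconjE // => <-.
by field; rewrite a0 b0.
Qed.

(** After [F32_gsum], [sum_two_characters] applies; its conditions on [P], [Q] and [P / Q] amount to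
    the nontriviality of [B], [phi A^3 / B] and [A^3 / B^2]. *)
Lemma F32_right (x : F) : x != 0 ->
  F32 (cexp A 3) D1 D2 (cmul (cexp A 3) (cconj B)) (cmul phi B) (x / 4%:R) =
  g phi * dsum P Q x / (g (cexp A 3) * g P * g Q) +
  delta (x + 2%:R^-1) * cexp A 3 2%:R * (g phi * g (cexp (cconj A) 3)) / (g P * g Q).
Proof.
move=> x0.
have := F32_gsum hpsi (x / 4%:R) hA3 hD1 hD2 hB2 hB1 h1 h3 nD2 nC1 nC2.
rewrite conjB1 conjB2 hsum_neq0 //.
set H := (X in _ = X).
have -> : H = g phi * (q * (phi (-1) * P (-1) * Q (-1)) * dsum P Q x +
      delta (x + 2%:R^-1) * q ^+ 2 * (phi 2%:R / (P 2%:R * Q 2%:R))).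
  rewrite -sum_two_characters //.
  - rewrite /H; apply: eq_bigr => r r0; apply: eq_bigr => s s0.
    apply: eq_bigr => t t0; apply: eq_bigr => y y0; apply: eq_bigr => z z0.
    congr (_ * psi _).
    rewrite /D1 /D2 !cmulE !cexpE !(cconjE _ hA) !(cconjE _ hB) !PE !QE.
    (* [t y z] and [y / (t z)] differ by the square of [t z], so this [phi] cancels the one
       contained in [P]. *)
    have -> : phi (t * y * z) = phi (y / (t * z)).
      rewrite (_ : t * y * z = (t * z) ^+ 2 * (y / (t * z))); last by field; rewrite t0 z0.
      by rewrite (mcharM hphi) qchar_sqr ?mul1r // mulf_neq0.
    have -> : phi (y / (t * z)) * (phi (y / (t * z)) / B (y / (t * z))) = (B (y / (t * z)))^-1.
      by rewrite mulrA qcharK ?mul1r // !mulf_neq0 ?invr_eq0 ?mulf_neq0.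
    rewrite !(mcharM hA) !(mcharM hB) !(mcharV hA) !(mcharV hB) !(mcharM hA) !(mcharM hB).
    rewrite [(phi s * _)^-1]invfM qcharV //.
    by field; rewrite !mchar_neq0 // t0 y0 z0 r0 s0.
  - apply: (neq_eps_imp hB h2) => y y0; rewrite cmulE PE mulrA qcharK // mul1r.
    by move/eqP; rewrite invr_eq1 => /eqP.
  - apply: (neq_eps_imp _ h5); first by apply: mchar_cmul => //; apply: mchar_cmul.
    move=> y y0; rewrite cmulE QE => e.
    have a0 : A y != 0 by rewrite mchar_neq0.
    have b0 : B y != 0 by rewrite mchar_neq0.
    have f0 : phi y != 0 by rewrite mchar_neq0.
    rewrite !cmulE cexpE cconjE // -[RHS]invr1 -e -[phi y in LHS]qcharV //.
    by field; rewrite f0 a0 b0.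
  - apply: (neq_eps_imp _ h3) => // y y0; rewrite !cmulE cconjE // PE QE => e.
    have a0 : A y != 0 by rewrite mchar_neq0.
    have b0 : B y != 0 by rewrite mchar_neq0.
    rewrite !cexpE cconjE // -[RHS]e -[LHS]mul1r -(qcharK odd_card y0).
    by field; rewrite a0 b0.
(* [D1] and [D2] are conjugate, as are [A^3] and its inverse, so both products of Gauss sums equal
   [A (-1) ^+ 3 * q]; trading one for the other gives the delta term its shape. *)
have gC : g D1 * g D2 = A (-1) ^+ 3 * q.
  rewrite -conjD1 gsum_mul_conj // /D1 cmulE !cexpE cconjE // exprVn expr2.
  by rewrite mcharN1 // invr1 mulr1.
have gA : g (cexp A 3) * g (cexp (cconj A) 3) = A (-1) ^+ 3 * q.
  rewrite (_ : cexp (cconj A) 3 = cconj (cexp A 3)) ?gsum_mul_conj //.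
  by apply: functional_extensionality => y; rewrite cexpE /cconj -rmorphXn.
have sgn : phi (-1) * P (-1) * Q (-1) = A (-1) ^+ 3.
  rewrite PE QE; transitivity (phi (-1) * phi (-1) * ((B (-1))^-1 * B (-1))
    * (cexp A 3 (-1))^-1); first by rewrite cexpE; ring.
  by rewrite (mcharN1V hA3) (mcharN1V hB) (mcharN1 hphi) (mcharN1 hB) !mul1r.
have val2 : phi 2%:R / (P 2%:R * Q 2%:R) = A 2%:R ^+ 3.
  by rewrite PE QE; field; rewrite !mchar_neq0 // two_neq0.
rewrite sgn val2.
have n1 := gsum_neq0 hpsi hA3; have n2 := gsum_neq0 hpsi hP.
have n3 := gsum_neq0 hpsi hQ; have n4 := gsum_neq0 hpsi hD1.
have n5 := gsum_neq0 hpsi hD2; have n6 := card_neq0 F.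
have s2 : A (-1) ^+ 3 != 0 by rewrite expf_neq0 // mchar_neq0 // oppr_eq0 oner_eq0.
move=> hF; have K0 : g (cexp A 3) * (g D1 * g D2) * (g P * g Q) != 0.
  by rewrite !mulf_neq0.
apply: (mulIf K0).
transitivity (g phi * (q * A (-1) ^+ 3 * dsum P Q x +
  delta (x + 2%:R^-1) * q ^+ 2 * A 2%:R ^+ 3)); first by rewrite -hF; ring.
rewrite gC cexpE.
transitivity (g phi * (q * A (-1) ^+ 3) * dsum P Q x +
  delta (x + 2%:R^-1) * A 2%:R ^+ 3 * g phi *
  (g (cexp A 3) * g (cexp (cconj A) 3)) * (A (-1) ^+ 3 * q)); last first.
  by field; rewrite n1 n2 n3.
rewrite gA.
have ss : A (-1) ^+ 3 * A (-1) ^+ 3 = 1 by rewrite -cexpE mcharN1.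
transitivity (g phi * (q * A (-1) ^+ 3 * dsum P Q x) +
  g phi * delta (x + 2%:R^-1) * q ^+ 2 * A 2%:R ^+ 3
    * (A (-1) ^+ 3 * A (-1) ^+ 3)); last by ring.
by rewrite ss; ring.
Qed.

(** * Evaluation of the left-hand side *)

Let nA : A <> eps.
Proof.
by apply: (neq_eps_imp hA3 h1) => y _ e; rewrite cexpE e expr1n.
Qed.

Let nA2 : cmul A eta <> eps.
Proof.
apply: (neq_eps_imp hA3 h1) => y y0; rewrite cmulE cexpE => e.
have := congr1 (fun z => z ^+ 3) e; rewrite expr1n => <-.
by rewrite exprMn (eta_cube heta3 y0) mulr1.
Qed.

Let nA3 : cmul A (cconj eta) <> eps.
Proof.
apply: (neq_eps_imp hA3 h1) => y y0; rewrite cmulE cexpE cconjE // => e.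
have := congr1 (fun z => z ^+ 3) e; rewrite expr1n => <-.
by rewrite exprMn exprVn (eta_cube heta3 y0) divr1.
Qed.

(** Passing to the third power removes [eta]: the inverse cube of this character is [phi A^3 / B^3].
    In the same way the cube of the character in [nE2] is [A^6 / B^3]. *)
Let nE1 : cmul (cmul phi B) (cconj (cmul A eta)) <> eps.
Proof.
apply: (neq_eps_imp _ h6).
  by do ?[apply: mchar_cmul]; rewrite //; apply: mchar_cexp.
move=> y y0; rewrite !cmulE !cexpE (cconjE _ (mchar_cmul hA heta)) !cconjE // cmulE => e.
have a0 : A y != 0 by rewrite mchar_neq0.
have b0 : B y != 0 by rewrite mchar_neq0.
have f0 : phi y != 0 by rewrite mchar_neq0.
have e0 : eta y != 0 by rewrite mchar_neq0.
have := congr1 (fun z => z ^- 3) e; rewrite expr1n invr1 => <-.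
rewrite -[LHS]mulr1 -(eta_cube heta3 y0).
transitivity (phi y ^+ 4 * (A y ^+ 3 * eta y ^+ 3 / (phi y * B y) ^+ 3)).
  by field; rewrite f0 b0.
have -> : phi y ^+ 4 = 1.
  by transitivity ((phi y * phi y) ^+ 2); [ring | rewrite qcharK // expr1n].
rewrite mul1r.
by field; rewrite a0 b0 f0 e0.
Qed.

Let nE2 : cmul (cmul (cexp A 3) (cconj B)) (cconj (cmul A (cconj eta))) <> eps.
Proof.
apply: (neq_eps_imp _ h4).
  by do ?[apply: mchar_cmul]; rewrite //; apply: mchar_cexp.
move=> y y0; rewrite !cmulE !cexpE (cconjE _ (mchar_cmul hA hetab)) cmulE !cconjE // => e.
have a0 : A y != 0 by rewrite mchar_neq0.
have b0 : B y != 0 by rewrite mchar_neq0.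
have e0 : eta y != 0 by rewrite mchar_neq0.
have := congr1 (fun z => z ^+ 3) e; rewrite expr1n => <-.
rewrite -[LHS]mulr1 -(eta_cube heta3 y0).
by field; rewrite a0 b0 e0.
Qed.

Lemma gsum_triple :
  g A * g (cmul A eta) * g (cmul A (cconj eta)) =
  q / A 3%:R ^+ 3 * g (cexp A 3).
Proof.
have [om omE] := exists_cube_root1 three_dvd.
have := triple_sum hpsi three_neq0 omE heta heta3 heta1 A.
have -> : \sum_(n | n != 0) psi (3%:R * n) * A (n ^+ 3) = (A 3%:R ^+ 3)^-1 * g (cexp A 3).
  rewrite -cexpE -gsum_twist // -sum_neq0_mchar //; apply: eq_bigr => n _.
  by rewrite mcharX // cexpE mulrC [n * _]mulrC.
rewrite mulrA => <-.
rewrite /gsum -!(sum_neq0_mchar psi) //; try by apply: mchar_cmul.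
rewrite mulr_suml mulr_suml; apply: eq_bigr => t t0.
rewrite -mulrA mulr_suml mulr_sumr; apply: eq_bigr => y y0.
rewrite mulrA mulr_sumr; apply: eq_bigr => z z0.
rewrite !cmulE cconjE // !(psiD hpsi) !(mcharM hA); ring.
Qed.

Lemma F32_left (x : F) : x != 1 ->
  cexp (cconj A) 3 (1 - x) *
    F32 A (cmul A eta) (cmul A (cconj eta)) (cmul phi B)
      (cmul (cexp A 3) (cconj B)) (27%:R * x / (4%:R * (x - 1) ^+ 3)) =
  g phi * dsum P Q x / (g (cexp A 3) * g P * g Q).
Proof.
move=> x1; set lam := 27%:R * x / _.
have [om omE] := exists_cube_root1 three_dvd.
have hA2 := mchar_cmul hA heta; have hA3' := mchar_cmul hA hetab.
have := F32_gsum hpsi lam hA hA2 hA3' hB1 hB2 nA nA2 nA3 nE1 nE2.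
rewrite conjB1 conjB2 hsum_neq0 // gsum_triple.
set H := (X in _ = X).
have x1' : 1 - x != 0 by rewrite subr_eq0 eq_sym.
have x1'' : x - 1 != 0 by rewrite subr_eq0.
have four_neq0 := natr4_neq0 two_neq0.
have -> : H = q * (A (1 - x) ^+ 3 / A 3%:R ^+ 3) * (g phi * dsum P Q x).
  rewrite -(dsum_gsum hpsi odd_card two_neq0 hP hQ x hA3); last first.
    move=> n n0; rewrite PE QE cexpE; field.
    by rewrite !mchar_neq0 // n0.
  transitivity (\sum_(r | r != 0) \sum_(s | s != 0)
      q * \sum_(n | n != 0) psi (3%:R * n) *
        (A (n ^+ 3) * P r * Q s * psi (r + s - lam * n ^+ 3 / (r * s)))).
    rewrite /H; apply: eq_bigr => r r0; apply: eq_bigr => s s0.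
    rewrite -(triple_sum hpsi three_neq0 omE heta heta3 heta1
      (fun m => A m * P r * Q s * psi (r + s - lam * m / (r * s)))).
    apply: eq_bigr => t t0; apply: eq_bigr => y y0; apply: eq_bigr => z z0.
    rewrite -conjB1 -conjB2 !cconjE // !(mcharM hA) [cmul A eta y]cmulE.
    rewrite [cmul A _ z]cmulE cconjE //.
    rewrite (_ : t + y + z + r + s - lam * (t * y * z) / (r * s) =
      t + y + z + (r + s - lam * (t * y * z) / (r * s))); last by ring.
    by rewrite [in LHS](psiD hpsi); ring.
  rewrite [in RHS]exchange_big mulr_sumr; apply: eq_bigr => r r0 /=.
  rewrite [in RHS]exchange_big mulr_sumr; apply: eq_bigr => s s0 /=.
  (* Scaling [n] by [(1 - x) / 3] turns [3 n] into [n - n x] and [- lam n^3] into [x n^3 / 4]; this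
     accounts for the constant [27 / 4], the cube of [x - 1] and the prefactor. *)
  have c0 : (1 - x) / 3%:R != 0 by rewrite mulf_neq0 ?invr_eq0.
  rewrite (reindex_scale_neq0 _ c0) !mulr_sumr; apply: eq_bigr => n n0.
  have -> : n - n * x + r + s + x * n ^+ 3 / (4%:R * r * s) =
    3%:R * ((1 - x) / 3%:R * n) +
      (r + s - lam * ((1 - x) / 3%:R * n) ^+ 3 / (r * s)).
    by rewrite /lam; field; rewrite r0 s0 four_neq0 three_neq0 x1''.
  rewrite [in RHS](psiD hpsi) !(mcharX hA) cexpE !(mcharM hA) !(mcharV hA).
  by field; rewrite mchar_neq0.
have n1 := gsum_neq0 hpsi hA3; have n2 := gsum_neq0 hpsi hP.
have n3 := gsum_neq0 hpsi hQ; have n6 := card_neq0 F.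
have n7 : A 3%:R != 0 by rewrite mchar_neq0.
have n8 : A (1 - x) != 0 by rewrite mchar_neq0.
move=> hF; have K0 : q / A 3%:R ^+ 3 * g (cexp A 3) * g P * g Q != 0.
  by rewrite !mulf_neq0 // invr_eq0 expf_neq0.
apply: (mulIf K0); rewrite -[LHS]mulrA hF cexpE cconjE //.
by field; rewrite n1 n2 n3 n7 n8.
Qed.

(** * The points [x = 1] and [x = 0] *)

Lemma sum_gsum_mul (X : F -> algC) : mchar X ->
  \sum_(w | w != 0) \sum_(r | r != 0) \sum_(s | s != 0)
    X w * (P r * Q s * psi (r + s + w / (4%:R * r * s))) =
  g X * g (cmul P X) * g (cmul Q X) * X 4%:R.
Proof.
move=> hX.
have four_neq0 := natr4_neq0 two_neq0.
rewrite exchange_big /=; under eq_bigr do rewrite exchange_big /=.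
have hPX := mchar_cmul hP hX; have hQX := mchar_cmul hQ hX.
rewrite /gsum -!(sum_neq0_mchar psi) //.
rewrite -mulrA [RHS]mulrC [_ * X 4%:R]mulrC mulrA [RHS]mulrC.
transitivity (\sum_(r | r != 0) \sum_(s | s != 0) \sum_(w | w != 0)
   X 4%:R * (cmul P X r * psi r) * (cmul Q X s * psi s) * (X w * psi w)).
  apply: eq_bigr => r r0; apply: eq_bigr => s s0.
  (* Replacing [w] by [4 r s w] separates the three variables. *)
  have c0 : 4%:R * r * s != 0 by rewrite !mulf_neq0.
  rewrite (reindex_scale_neq0 _ c0); apply: eq_bigr => w w0.
  rewrite !cmulE !(mcharM hX) [_ * w / _]mulrC mulKf // !(psiD hpsi).
  by ring.
under eq_bigr do under eq_bigr do rewrite -mulr_sumr.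
under eq_bigr do rewrite -mulr_suml -mulr_sumr.
rewrite -mulr_suml -mulr_suml -mulr_sumr; ring.
Qed.

(** At [x = 1] the linear terms in [n] cancel, so the summand depends on [n^3] only, and [sum_cubes]
    splits the sum according to the three characters with the same cube as [A]. *)
Lemma cubic_sum :
  \sum_(X <- [:: A; cmul A eta; cmul A (cconj eta)])
    g X * g (cmul P X) * g (cmul Q X) * X 4%:R = g phi * dsum P Q 1.
Proof.
have hA2 := mchar_cmul hA heta; have hA3' := mchar_cmul hA hetab.
rewrite -(dsum_gsum hpsi odd_card two_neq0 hP hQ 1 hA3); last first.
  move=> n n0; rewrite PE QE cexpE; field.
  by rewrite !mchar_neq0 // n0.
pose f w := A w * \sum_(r | r != 0) \sum_(s | s != 0)
    P r * Q s * psi (r + s + w / (4%:R * r * s)).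
transitivity (\sum_(n | n != 0) f (n ^+ 3)); last first.
  apply: eq_bigr => n n0; rewrite /f mulr_sumr; apply: eq_bigr => r r0.
  rewrite mulr_sumr; apply: eq_bigr => s s0.
  by rewrite mcharX // cexpE mulr1 subrr add0r mul1r !mulrA.
rewrite (sum_cubes three_dvd three_neq0 heta heta3 heta1) /f.
rewrite !big_cons big_nil addr0 -!sum_gsum_mul // -!big_split /=.
apply: eq_bigr => w w0.
under eq_bigr do rewrite -mulr_sumr.
under [X in _ + (X + _)]eq_bigr do rewrite -mulr_sumr.
under [X in _ + (_ + X)]eq_bigr do rewrite -mulr_sumr.
rewrite -!mulr_sumr !cmulE (eta_conj heta heta3 w0); ring.
Qed.

Lemma F32_left0 :
  F32 A (cmul A eta) (cmul A (cconj eta)) (cmul phi B)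
    (cmul (cexp A 3) (cconj B)) 0 = 1.
Proof. by apply: (F32_0 hpsi) => //; apply: mchar_cmul. Qed.

Lemma F32_right0 :
  F32 (cexp A 3) D1 D2 (cmul (cexp A 3) (cconj B)) (cmul phi B) 0 = 1.
Proof. exact: (F32_0 hpsi). Qed.

End Transformation.

(** * Gauss sums of the trace character and the final comparison *)

Lemma gauss_gsum (F : finFieldType) (p : nat) (X : F -> algC) :
  mchar X -> gauss p X = gsum (trace_char p) X.
Proof. by move=> hX; rewrite /gauss (sum_neq0_mchar (trace_char p)). Qed.

Lemma natr_pchar_neq0 (F : finFieldType) (p n : nat) :
  p \in [pchar F] -> prime n -> ~~ (n %| #|F|)%N -> (n%:R : F) != 0.
Proof.
move=> hp pn; apply: contra; rewrite -(dvdn_pcharf hp) dvdn_prime2 //.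
  move/eqP <-; rewrite (card_pchar hp) dvdn_exp ?logn_card_gt0 //.
exact: pcharf_prime hp.
Qed.

Theorem mainTheorem11 (F : finFieldType) (p : nat) (hp : p \in [pchar F])
  (hq : (#|F| %% 6 = 1)%N)
  (eta A B : F -> algC)
  (heta : mchar eta) (heta3 : cexp eta 3 = eps) (heta1 : eta <> eps)
  (hA : mchar A) (hB : mchar B)
  (h1 : cexp A 3 <> eps)
  (h2 : B <> eps)
  (h3 : cmul (cexp A 3) (cexp (cconj B) 2) <> eps)
  (h4 : cmul (cexp A 6) (cexp (cconj B) 3) <> eps)
  (h5 : cmul (cmul qchar (cexp A 3)) (cconj B) <> eps)
  (h6 : cmul (cmul qchar (cexp A 3)) (cexp (cconj B) 3) <> eps)
  (x : F) :
  (if x == 1 then 0 else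
     cexp (cconj A) 3 (1 - x) *
     F32 A (cmul A eta) (cmul A (cconj eta)) (cmul qchar B)
         (cmul (cexp A 3) (cconj B)) (27%:R * x / (4%:R * (x - 1) ^+ 3)))
  =
  F32 (cexp A 3) (cmul (cexp A 3) (cexp (cconj B) 2))
      (cmul (cexp (cconj A) 3) (cexp B 2))
      (cmul (cexp A 3) (cconj B)) (cmul qchar B) (x / 4%:R)
  - delta (x + 2%:R^-1) * cexp A 3 2%:R
      * (gauss p (@qchar F) * gauss p (cexp (cconj A) 3))
      / (gauss p (cmul qchar (cconj B)) * gauss p (cmul (cexp (cconj A) 3) B))
  - delta (1 - x) *
    char_sum (fun chi => cexp chi 3 = cexp (cconj A) 3)
      (fun chi =>
         gauss p (cconj chi) * gauss p (cmul qchar (cconj (cmul B chi)))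
         * gauss p (cmul B (cconj (cmul (cexp A 3) chi)))
         / (gauss p (cmul qchar (cconj B)) * gauss p (cmul (cexp (cconj A) 3) B)
            * gauss p (cexp A 3))
         * cconj chi 4%:R).
Proof.
have hpsi := trace_char_add hp.
have nd n : (1 < n)%N -> (n %| 6)%N -> ~~ (n %| #|F|)%N.
  by move=> n1 n6; rewrite /dvdn -(modn_dvdm _ n6) hq modn_small.
have odd_card : odd #|F| by rewrite -[odd _]negbK -dvdn2 nd.
have two_neq0 : (2%:R : F) != 0 by apply: natr_pchar_neq0 hp _ _; rewrite ?nd.
have three_neq0 : (3%:R : F) != 0 by apply: natr_pchar_neq0 hp _ _; rewrite ?nd.
have three_dvd : (3 %| #|F|.-1)%N.
  rewrite -subn1 -eqn_mod_dvd ?card_field_gt0 //.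
  by rewrite -(@modn_dvdm 6 #|F|) // hq.
have hphi := mchar_qchar odd_card.
have hAb := mchar_cconj hA; have hBb := mchar_cconj hB.
have hA3 := mchar_cexp 2 hA; have hAb3 := mchar_cexp 2 hAb.
have hP := mchar_cmul hphi hBb; have hQ := mchar_cmul hAb3 hB.
have hetab := mchar_cconj heta.
rewrite (gauss_gsum p hphi) (gauss_gsum p hAb3) (gauss_gsum p hP) (gauss_gsum p hQ).
(* At [x = 0] both arguments are zero and both functions equal [1]; the evaluation in [F32_right]
   assumes [x != 0]. *)
have [->|x0] := eqVneq x 0.
  rewrite eq_sym oner_eq0 mulr0 !mul0r subr0 add0r (F32_left0 hpsi) // (F32_right0 hpsi) //.
  rewrite /delta oner_eq0 invr_eq0 (negPf two_neq0) !mul0r !subr0 mulr1.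
  by rewrite cexpE mchar1 // expr1n.
(* The term at [x = - 1/2] cancels against the one in [F32_right]. For [x != 1] the rest is
   [F32_left]; at [x = 1] it must equal the character sum. *)
rewrite (F32_right hpsi) // addrK /delta; have [->|x1] := eqVneq x 1; last first.
  by rewrite (F32_left hpsi) // subr_eq0 eq_sym (negPf x1) mul0r subr0.
rewrite subrr eqxx mul1r (char_sum_cubic heta heta3 heta1) //.
set g := gsum (trace_char p); set P := cmul qchar _; set Q := cmul (cexp _ 3) B.
(* The characters of the sum are [cconj X] with [X] one of [A], [A eta], [A / eta], which brings
   each term to the shape in [cubic_sum]. *)
have termE X : mchar X ->
    gauss p (cconj (cconj X)) * gauss p (cmul qchar (cconj (cmul B (cconj X))))
     * gauss p (cmul B (cconj (cmul (cexp A 3) (cconj X))))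
     / (g P * g Q * gauss p (cexp A 3)) * cconj (cconj X) 4%:R =
    g X * g (cmul P X) * g (cmul Q X) * X 4%:R / (g (cexp A 3) * g P * g Q).
  move=> hX; have hX' := mchar_cconj hX.
  have -> : cconj (cconj X) = X.
    by apply: functional_extensionality => y; rewrite /cconj conjCK.
  have -> : cmul qchar (cconj (cmul B (cconj X))) = cmul P X.
    apply: functional_extensionality => y.
    by rewrite /P /cmul /cconj rmorphM /= conjCK mulrA.
  have -> : cmul B (cconj (cmul (cexp A 3) (cconj X))) = cmul Q X.
    apply: functional_extensionality => y.
    by rewrite /Q /cmul /cconj /cexp rmorphM rmorphXn /= conjCK mulrCA mulrA.
  rewrite !gauss_gsum //; try exact: mchar_cmul.
  by rewrite -[gsum _]/g [g P * g Q * _]mulrC mulrA [LHS]mulrAC.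
rewrite !termE //; try exact: mchar_cmul.
rewrite -!mulrDl -(cubic_sum hpsi odd_card three_dvd two_neq0 three_neq0 heta heta3 heta1 hA hB).
by rewrite !big_cons big_nil addr0 !addrA subrr.
Qed.
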